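(* There exist a Banach space $X$ with a Schauder basis, a Banach space $Y$ and a compact linear operator $T: X\to Y$ which cannot be approximated by norm-attaining operators, i.e. $T$ does not belong to the operator-norm closure of $NA(X,Y)$ in $L(X,Y)$.
   Context: Banach spaces are real or complex (with $X$ and $Y$ over the same scalar field). $L(X,Y)$ is the Banach space of all bounded linear operators from $X$ to $Y$ with the operator norm. An operator $T\in L(X,Y)$ attains its norm if there is $x\in X$ with $\|x\|=1$ and $\|T(x)\|=\|T\|$; $NA(X,Y)$ denotes the set of all norm-attaining operators in $L(X,Y)$. *)

(* Defs.v *)
From HB Require Import structures.
From mathcomp Require Import all_boot all_order all_algebra.
From mathcomp Require Import boolp classical_sets functions reals topology.
From mathcomp Require Import normedtype sequences.
From mathcomp Require Export complex.

Set Implicit Arguments.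
Unset Strict Implicit.
Unset Printing Implicit Defensive.

Import Order.TTheory GRing.Theory Num.Theory.
Import numFieldNormedType.Exports.

Local Open Scope classical_set_scope.
Local Open Scope ring_scope.

(* Everything is stated over K : numFieldType so as to cover both K = R and
   K = R[i] with R : realType.  Norms are K-valued and, for z in R[i], the order
   0 <= z means that z is a nonnegative real; hence inequalities between norms
   and suprema of sets of norms have their usual meaning in both cases. *)

(* The basis is indexed by nat, so X is necessarily infinite-dimensional. *)
Definition schauder_basis (K : numFieldType) (X : normedModType K)
    (e : nat -> X) : Prop :=
  forall x : X, exists! a : nat -> K, series (fun n => a n *: e n) @ \oo --> x.

Definition bounded_operator (K : numFieldType) (X Y : normedModType K)
    (T : {linear X -> Y}) : Prop :=
  exists M : K, forall x : X, `|T x| <= M * `|x|.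

Definition compact_operator (K : numFieldType) (X Y : normedModType K)
    (T : {linear X -> Y}) : Prop :=
  compact (closure (T @` [set x : X | `|x| <= 1])).

(* Defined on bare functions so that it applies to differences T \- S; it is the
   operator norm as soon as T is linear and bounded (the default value 0 of
   supremum is only returned when the set has no least upper bound). *)
Definition opnorm (K : numFieldType) (X Y : normedModType K)
    (T : X -> Y) : K :=
  supremum 0 [set `|T x| | x in [set x : X | `|x| <= 1]].

Definition norm_attaining (K : numFieldType) (X Y : normedModType K) :
    set {linear X -> Y} :=
  [set T | bounded_operator T /\ exists x : X, `|x| = 1 /\ `|T x| = opnorm T].

(* Meant for bounded T; compact operators are bounded. *)
Definition opnorm_closure (K : numFieldType) (X Y : normedModType K)
    (A : set {linear X -> Y}) : set {linear X -> Y} :=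
  [set T | forall eps : K, 0 < eps -> exists2 S, A S & opnorm (T \- S) < eps].

(* Main.v *)
Require Import Defs.
From HB Require Import structures.
From mathcomp Require Import all_boot all_order all_algebra.
From mathcomp Require Import boolp classical_sets functions reals topology.
From mathcomp Require Import normedtype sequences.
From mathcomp Require Import ring lra zify.
Import Order.TTheory GRing.Theory Num.Theory.
Import numFieldNormedType.Exports.

Set Implicit Arguments.
Unset Strict Implicit.
Unset Printing Implicit Defensive.

Local Open Scope classical_set_scope.
Local Open Scope ring_scope.

(** Let X be a closed subspace of c_0, let S : X -> Y attain its norm at a unit
    vector x0, and let Y be strictly convex.  Only finitely many coordinates of
    x0 have modulus at least 1/2, so x0 + y and x0 - y stay in the unit ball
    whenever y is small and vanishes at these coordinates (X_flat).  Then
    S x0 + S y and S x0 - S y have norm at most the norm of S x0, and strict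
    convexity gives S y = 0: an operator that attains its norm has finite rank.
    It remains to find a closed subspace X of c_0 with a Schauder basis, a
    strictly convex Y and a compact T : X -> Y which is not a limit of operators
    of finite rank.

    The failure of approximation comes from Davie's form of Enflo's example.
    The atoms e_w, indexed by the words w over an alphabet of 16 letters, are
    sign functions; e_w is supported by the levels |w| and |w| - 1 of a set of
    sites.  On each level, the atoms living there are orthogonal, so that the
    coordinate functional alpha_w of e_w is an average over either of its two
    levels (alpha_sigma_atom, alpha_tau_atom).  Consequently the difference of
    two consecutive normalized traces

      beta_n(Q) = 16^-n * sum_(|w| = n) alpha_w (Q e_w)

    is an average, over the sites g of level n, of the values at g of Q applied
    to a vector whose supremum norm is at most 2 * 2^-n (davie_small).  This
    smallness is the incoherence of sign patterns: letter by letter the relevant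
    correlations are sums of 16 signs of a quadratic function on F_2^4 that is
    not affine, and such sums are at most 8.  With T the multiplication by
    (3/4)^n on level n, and alpha_w rescaled accordingly, beta_n(T) = 1 for all
    n, beta_n(Q) is bounded by a constant times the norm of Q because
    (1/2) / (3/4) < 1 (trace_bound), and beta_n(Q) tends to 0 when Q has finite
    rank (trace_finite_rank).  Hence T is at a positive distance from the
    operators of finite rank.

    The closed span of the atoms has no basis.  It is replaced by the space of
    coefficient sequences a for which the series of the a_j x_j converges, where
    the sequence x enumerates the atoms with many repetitions.  The unit vectors
    form a basis of that space (tail_schauder), and normed by the suprema of the
    tails it is a subspace of c_0, each coefficient sequence being identified
    with the family of its tails.  The repetitions in x provide linear liftings
    of the spans of finitely many atoms, with a bound 2 on their norms
    (lifting_bound), through which the traces above are pulled back.  As for Y,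
    it is the closure of the range of T, with a strictly convex norm equivalent
    to the supremum norm (rot_strict).

    Signs are integers, so that the same construction serves for real and for
    complex scalars; the record scalars collects what is used about them. *)

(** * Scalars *)

Section LinearFunctions.
Context (K : numFieldType) (U V : lmodType K) (Q : U -> V).
Hypothesis Qlin : linear Q.

Lemma linear_at0 : Q 0 = 0.
Proof. by have := Qlin (-1) 0 0; rewrite scaler0 addr0 scaleN1r addNr. Qed.

Lemma linear_comb (I : Type) (r : seq I) (c : I -> K) (x : I -> U) :
  Q (\sum_(i <- r) c i *: x i) = \sum_(i <- r) c i *: Q (x i).
Proof.
elim: r => [|i r IH]; last by rewrite !big_cons Qlin IH.
by rewrite !big_nil linear_at0.
Qed.

End LinearFunctions.

(** K stands for R or for R[i].  Norms are K-valued, but they all come from R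
    through emb, so that suprema and square roots can be taken in R.  The
    parallelogram law is there for the strictly convex norm, and nr_ultra, the
    compactness of closed balls, for completeness and for compact operators. *)
Record scalars (R : realType) (K : numFieldType) := Scalars {
  emb : {rmorphism R -> K};
  emb_mono : {mono emb : x y / x <= y};
  nr : K -> R;
  nrE : forall z : K, `|z| = emb (nr z);
  nr_parallelogram : forall a b : K,
    nr (a + b) ^+ 2 + nr (a - b) ^+ 2 = (nr a ^+ 2 + nr b ^+ 2) *+ 2;
  nr_ultra : forall (F : set_system K) (B : R), UltraFilter F ->
    F [set z | nr z <= B] ->
    exists l, forall eps : R, 0 < eps -> F [set z | nr (z - l) < eps] }.

Section ScalarTheory.
Context (R : realType) (K : numFieldType) (sc : scalars R K).
Local Notation nr := (nr sc).
Local Notation emb := (emb sc).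
Local Notation nrE := (nrE sc).

Lemma emb_inj : injective emb.
Proof. exact: inc_inj (emb_mono sc). Qed.

Lemma emb_lt : {mono emb : x y / x < y}.
Proof. exact: leW_mono (emb_mono sc). Qed.

Lemma emb_ge0 x : (0 <= emb x) = (0 <= x).
Proof. by rewrite -(rmorph0 emb) (emb_mono sc). Qed.

Lemma nr_ge0 z : 0 <= nr z.
Proof. by rewrite -emb_ge0 -nrE. Qed.

Lemma nr0 : nr 0 = 0.
Proof. by apply: emb_inj; rewrite -nrE normr0 rmorph0. Qed.

Lemma nr0_eq0 z : nr z = 0 -> z = 0.
Proof. by move=> z0; apply: normr0_eq0; rewrite nrE z0 rmorph0. Qed.

Lemma nr1 : nr 1 = 1.
Proof. by apply: emb_inj; rewrite -nrE normr1 rmorph1. Qed.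

Lemma nrN z : nr (- z) = nr z.
Proof. by apply: emb_inj; rewrite -!nrE normrN. Qed.

Lemma nrM a b : nr (a * b) = nr a * nr b.
Proof. by apply: emb_inj; rewrite rmorphM -!nrE normrM. Qed.

Lemma nrD a b : nr (a + b) <= nr a + nr b.
Proof. by rewrite -(emb_mono sc) rmorphD -!nrE ler_normD. Qed.

Lemma nrB a b : nr (a - b) <= nr a + nr b.
Proof. by rewrite -[nr b]nrN nrD. Qed.

Lemma nr_distC a b : nr (a - b) = nr (b - a).
Proof. by rewrite -nrN opprB. Qed.

Lemma nr_tri a b c : nr (a - c) <= nr (a - b) + nr (b - c).
Proof. by apply: le_trans (nrD _ _); rewrite addrA subrK. Qed.

Lemma nr_emb x : nr (emb x) = `|x|.
Proof.
apply: emb_inj; rewrite -nrE; case: (ger0P x) => [x0|/ltW x0].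
  by rewrite ger0_norm // emb_ge0.
by rewrite rmorphN ler0_norm // -(rmorph0 emb) emb_mono.
Qed.

Lemma nr_sum (J : Type) (s : seq J) (P : pred J) (f : J -> K) :
  nr (\sum_(j <- s | P j) f j) <= \sum_(j <- s | P j) nr (f j).
Proof.
elim/big_ind2: _ => [|x a y b xa yb|//]; first by rewrite nr0.
by apply: le_trans (nrD _ _) _; exact: lerD.
Qed.

(** The inequality for the inverse scalar yields the converse inequality. *)
Lemma homogeneous_of_le (V : lmodType K) (P : set V) (N : V -> R) :
  (forall a f, P f -> P (a *: f)) -> (forall f, P f -> 0 <= N f) ->
  (forall a f, P f -> N (a *: f) <= nr a * N f) ->
  forall a f, P f -> N (a *: f) = nr a * N f.
Proof.
move=> PZ N0 NZ a f Pf; apply/eqP; rewrite eq_le NZ //=.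
have [->|a0] := eqVneq a 0; first by rewrite nr0 mul0r N0 //; exact: PZ.
have na0 : 0 < nr a.
  by rewrite lt_neqAle nr_ge0 andbT eq_sym; apply: contra_neq a0; exact: nr0_eq0.
have : nr a * N (a^-1 *: (a *: f)) <= nr a * (nr a^-1 * N (a *: f)).
  by rewrite ler_pM2l //; exact/NZ/PZ.
by rewrite scalerA mulVf // scale1r mulrA -nrM mulfV // nr1 mul1r.
Qed.

Lemma emb_nr_ge0 z : 0 <= z -> z = emb (nr z).
Proof. by move=> z0; rewrite -nrE ger0_norm. Qed.

(** A Cauchy filter contains a bounded set, so an ultrafilter finer than it
    converges, and the Cauchy filter has the same limit. *)
Lemma nr_cauchy (F : set_system K) : ProperFilter F ->
  (forall eps : R, 0 < eps -> exists z, F [set w | nr (w - z) < eps]) ->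
  exists l, forall eps : R, 0 < eps -> F [set w | nr (w - l) < eps].
Proof.
move=> PF cF; have [G [UG FG]] := ultraFilterLemma PF.
have [z0 Fz0] := cF 1 ltr01.
have [|l Gl] := @nr_ultra _ _ sc G (1 + nr z0) UG.
  apply: filterS (FG _ Fz0) => w /= /ltW wz.
  by rewrite -[w](subrK z0); apply: le_trans (nrD _ _) _; rewrite lerD2r.
exists l => eps e0; have e20 : 0 < eps / 2 by rewrite divr_gt0.
have e40 : 0 < eps / 2 / 2 by rewrite divr_gt0.
have [z Fz] := cF _ e40.
have PG : ProperFilter G by exact: ultra_proper.
have /filter_ex[w /= [wz wl]] :
    G ([set w | nr (w - z) < eps / 2 / 2] `&` [set w | nr (w - l) < eps / 2]).
  by apply: filterI; [exact: FG|exact: Gl].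
apply: filterS Fz => y /= yz; apply: le_lt_trans (nr_tri _ z _) _.
rewrite [ltRHS](splitr eps) [X in _ < X + _](splitr (eps / 2)) -addrA ltrD //.
by apply: le_lt_trans (nr_tri _ w _) _; rewrite ltrD // nr_distC.
Qed.

End ScalarTheory.

(** * Banach spaces of functions *)

(** The form in which both X and Y are obtained: a vector space of functions
    closed under uniform limits, with a norm gauge equivalent to the supremum
    norm. *)
Record fspace (R : realType) (K : numFieldType) (sc : scalars R K) (I : Type) :=
  FSpace {
  carrier : set (I -> K);
  gauge : (I -> K) -> R;
  carrier0 : carrier 0;
  carrier_lin : forall (a : K) f g, carrier f -> carrier g -> carrier (a *: f + g);
  gaugeD : forall f g, carrier f -> carrier g -> gauge (f + g) <= gauge f + gauge g;
  gaugeZ : forall (a : K) f, carrier f -> gauge (a *: f) = nr sc a * gauge f;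
  gauge_ge : forall f i, carrier f -> nr sc (f i) <= gauge f;
  gauge_cst : R;
  gauge_le : forall f B, carrier f -> 0 <= B ->
    (forall i, nr sc (f i) <= B) -> gauge f <= gauge_cst * B;
  carrier_closed : forall f, (forall eps : R, 0 < eps ->
    exists2 g, carrier g & forall i, nr sc (f i - g i) <= eps) -> carrier f }.

Section FspaceType.
Context (R : realType) (K : numFieldType) (sc : scalars R K) (I : Type).
Context (p : fspace sc I).
Local Notation nrE := (nrE sc).

Definition carrier_pred : {pred I -> K} := [pred f | `[< carrier p f >]].

Lemma carrier_predP f : reflect (carrier p f) (f \in carrier_pred).
Proof. exact: asboolP. Qed.

Fact carrier_submod : GRing.submod_closed carrier_pred.
Proof.
split; first by apply/carrier_predP; exact: carrier0.
move=> a f g /carrier_predP pf /carrier_predP pg.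
by apply/carrier_predP; exact: carrier_lin.
Qed.

HB.instance Definition _ :=
  GRing.isSubmodClosed.Build K (I -> K) carrier_pred carrier_submod.

Record felt := Felt { fval : I -> K; fvalP : fval \in carrier_pred }.

HB.instance Definition _ := [isSub for fval].
HB.instance Definition _ := [Choice of felt by <:].
HB.instance Definition _ := [SubChoice_isSubLmodule of felt by <:].

Lemma carrier_fval (x : felt) : carrier p (fval x).
Proof. by apply/carrier_predP; exact: fvalP. Qed.

Lemma fvalD (x y : felt) i : fval (x + y) i = fval x i + fval y i.
Proof. by []. Qed.
Lemma fvalB (x y : felt) i : fval (x - y) i = fval x i - fval y i.
Proof. by []. Qed.
Lemma fvalZ (a : K) (x : felt) i : fval (a *: x) i = a * fval x i.
Proof. by []. Qed.
Lemma fval0 i : fval (0 : felt) i = 0.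
Proof. by []. Qed.
Lemma fval_sum (J : Type) (s : seq J) (P : pred J) (F : J -> felt) i :
  fval (\sum_(j <- s | P j) F j) i = \sum_(j <- s | P j) fval (F j) i.
Proof. by elim/big_rec2: _ => //= j y1 y2 _ <-. Qed.

Definition fnorm (x : felt) : R := gauge p (fval x).

Lemma fnorm_ge x i : nr sc (fval x i) <= fnorm x.
Proof. exact/gauge_ge/carrier_fval. Qed.

Fact knormD x y : emb sc (fnorm (x + y)) <= emb sc (fnorm x) + emb sc (fnorm y).
Proof. by rewrite -rmorphD (emb_mono sc); apply: gaugeD; exact: carrier_fval. Qed.

Fact knormZ (a : K) x : emb sc (fnorm (a *: x)) = `|a| * emb sc (fnorm x).
Proof. by rewrite nrE -rmorphM; congr (emb sc _); exact/gaugeZ/carrier_fval. Qed.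

Fact knorm_eq0 x : emb sc (fnorm x) = 0 -> x = 0.
Proof.
rewrite -(rmorph0 (emb sc)) => /emb_inj x0; apply/val_inj/funext => i /=.
apply: (nr0_eq0 (sc := sc)); apply: le_anti; rewrite nr_ge0 andbT -x0.
exact: fnorm_ge.
Qed.

HB.instance Definition _ :=
  @Lmodule_isNormed.Build K felt (fun x => emb sc (fnorm x)) knormD knormZ knorm_eq0.

Lemma feltE (x : felt) : `|x| = emb sc (fnorm x).
Proof. by []. Qed.

Lemma fnorm_ge0 (x : felt) : 0 <= fnorm x.
Proof. by rewrite -(emb_ge0 sc) -feltE. Qed.

Lemma fnorm0 : fnorm 0 = 0.
Proof. by apply: (emb_inj (sc := sc)); rewrite -feltE normr0 rmorph0. Qed.

Lemma fnorm_eq0 (x : felt) : fnorm x = 0 -> x = 0.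
Proof. by move=> x0; apply: normr0_eq0; rewrite feltE x0 rmorph0. Qed.

Lemma fnormZ (a : K) (x : felt) : fnorm (a *: x) = nr sc a * fnorm x.
Proof. exact/gaugeZ/carrier_fval. Qed.

End FspaceType.

Section FspaceComplete.
Context (R : realType) (K : numFieldType) (sc : scalars R K) (I : Type).
Context (p : fspace sc I).
Local Notation nr := (nr sc).
Local Notation emb := (emb sc).
Local Notation T := (felt p).

Lemma emb_nr_gt0 (e : K) : 0 < e -> e = emb (nr e) /\ 0 < nr e.
Proof.
move=> e0; have E : e = emb (nr e) by apply: emb_nr_ge0; exact: ltW.
by split=> //; rewrite -(emb_lt sc) rmorph0 -E.
Qed.

Lemma fnorm_le (x : T) B : 0 <= B -> (forall i, nr (fval x i) <= B) ->
  fnorm x <= gauge_cst p * B.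
Proof. by move=> B0 xB; apply: gauge_le => //; exact: carrier_fval. Qed.

Lemma unif_cvg (F : set_system T) (L : T) : Filter F ->
  (forall eps, 0 < eps -> F [set y | forall i, nr (fval y i - fval L i) <= eps]) ->
  F --> L.
Proof.
move=> FF FL; apply/cvgrPdist_le => e /emb_nr_gt0[eE e0].
pose C := `|gauge_cst p| + 1.
have C0 : 0 < C by rewrite ltr_wpDl.
apply: filterS (FL (nr e / C) _) => [y /= yL|]; last by rewrite divr_gt0.
rewrite distrC feltE eE (emb_mono sc).
have : fnorm (y - L) <= gauge_cst p * (nr e / C).
  by apply: fnorm_le => //; rewrite divr_ge0 // ltW.
move=> /le_trans; apply.
rewrite mulrA ler_pdivrMr // mulrC ler_pM2l //.
by rewrite (le_trans (ler_norm _)) // lerDl.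
Qed.

(** As soon as F contains uniform balls of arbitrarily small radius, a pointwise
    limit along F is a uniform limit.  The centers of the balls are elements of
    the space in the proof of completeness, and the limit function itself in
    the proof that the operator is compact. *)
Lemma pointwise_unif_cvg (F : set_system T) (l : I -> K) : ProperFilter F ->
  (forall i eps, 0 < eps -> F [set y | nr (fval y i - l i) < eps]) ->
  (forall eps, 0 < eps -> exists x : I -> K,
     F [set y | forall i, nr (fval y i - x i) <= eps]) ->
  exists2 L : T, fval L = l & F --> L.
Proof.
move=> PF Fl Fx.
have FU eps : 0 < eps -> F [set y | forall i, nr (fval y i - l i) <= eps].
  move=> e0; have e20 : 0 < eps / 2 by rewrite divr_gt0.
  have [x Fxe] := Fx _ e20; apply: filterS (Fxe) => y /= yx i.
  apply/ler_addgt0Pr => d d0.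
  have /filter_ex[w /= [wx wl]] : F ([set y | forall i, nr (fval y i - x i) <= eps / 2]
      `&` [set y | nr (fval y i - l i) < d]).
    by apply: filterI => //; exact: Fl.
  apply: le_trans (nr_tri _ _ (fval w i) _) _.
  rewrite lerD ?(ltW wl) // [leRHS]splitr.
  by apply: le_trans (nr_tri _ _ (x i) _) _; rewrite lerD // nr_distC.
have lc : l \in carrier_pred p.
  apply/carrier_predP/carrier_closed => eps e0.
  have /filter_ex[y /= yl] := FU _ e0.
  exists (fval y); first exact: carrier_fval.
  by move=> i; rewrite nr_distC.
exists (Felt lc) => //; exact: unif_cvg.
Qed.

Lemma felt_complete (F : set_system T) : ProperFilter F -> cauchy F -> cvg F.
Proof.
move=> PF /(@cauchyP K T F PF) cF.
have Fx eps : 0 < eps -> exists x : T, F [set y | forall i, nr (fval y i - fval x i) < eps].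
  move=> e0; have [|x Fx] := cF (emb eps).
    by rewrite -(rmorph0 emb) (emb_lt sc).
  exists x; apply: filterS Fx => y; rewrite -ball_normE /= distrC feltE (emb_lt sc) => yx i.
  by apply: le_lt_trans yx; rewrite -fvalB; exact: fnorm_ge.
have /choice[l Fl] (i : I) : exists li, forall eps : R, 0 < eps ->
    F [set y | nr (fval y i - li) < eps].
  apply: (@nr_cauchy _ _ sc ((fun y : T => fval y i) @ F)) => eps /Fx[x Fxe].
  exists (fval x i).
  suff : F [set y | nr (fval y i - fval x i) < eps] by [].
  by apply: filterS Fxe => y /= /(_ i).
have [//|eps e0|L _ FL] := @pointwise_unif_cvg F l PF; last exact: cvgP FL.
have [x Fxe] := Fx _ e0; exists (fval x).
by apply: filterS Fxe => y /= yx i; exact: ltW.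
Qed.

HB.instance Definition _ := Uniform_isComplete.Build T felt_complete.

End FspaceComplete.

(** * The supremum norm and spaces of tails *)
Section SupNorm.
Context (R : realType) (K : numFieldType) (sc : scalars R K).
Local Notation nr := (nr sc).

Lemma nr_small_eq0 z c : 0 <= c -> (forall eps, 0 < eps -> nr z <= c * eps) -> z = 0.
Proof.
move=> c0 ze; apply: (nr0_eq0 (sc := sc)); apply/eqP; rewrite eq_le nr_ge0 andbT.
apply/ler_addgt0Pr => d d0; rewrite add0r.
have c1 : 0 < c + 1 by rewrite ltr_wpDl.
apply: le_trans (ze (d / (c + 1)) _) _; first by rewrite divr_gt0.
by rewrite mulrCA ler_piMr ?(ltW d0) // ler_pdivrMr // mul1r lerDl.
Qed.

Context (I : eqType).
Implicit Types f g : I -> K.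

(** Over an unbounded set, sup takes a default value; hence the boundedness
    assumptions below. *)
Definition supn f : R := sup (range (fun i => nr (f i))).

(** Membership in c_0(I). *)
Definition vanishing f := forall eps, 0 < eps ->
  exists s : seq I, forall i, i \notin s -> nr (f i) < eps.

Definition bounded f := exists B, forall i, nr (f i) <= B.

Lemma vanishing_bounded f : vanishing f -> bounded f.
Proof.
move=> /(_ 1 ltr01)[s fs]; exists (1 + \sum_(j <- s) nr (f j)) => i.
have s0 : 0 <= \sum_(j <- s) nr (f j) by apply: sumr_ge0 => j _; exact: nr_ge0.
case: (boolP (i \in s)) => [si|/fs/ltW fi]; last by rewrite (le_trans fi) // lerDl.
rewrite -[leLHS]add0r lerD //.
by rewrite (big_rem i) //= lerDl sumr_ge0 // => j _; exact: nr_ge0.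
Qed.

Lemma supn_ge f i : bounded f -> nr (f i) <= supn f.
Proof.
move=> [B fB]; apply: ub_le_sup; last by exists i.
by exists B => _ [j _ <-]; exact: fB.
Qed.

Lemma supn_le (i0 : I) f B : (forall i, nr (f i) <= B) -> supn f <= B.
Proof.
move=> fB; apply: ge_sup; first by exists (nr (f i0)), i0.
by move=> _ [j _ <-]; exact: fB.
Qed.

Lemma supnD (i0 : I) f g : bounded f -> bounded g -> supn (f + g) <= supn f + supn g.
Proof.
move=> bf bg; apply: (supn_le i0) => i; apply: le_trans (nrD _ _ _) _.
by apply: lerD; exact: supn_ge.
Qed.

Lemma boundedZ a f : bounded f -> bounded (a *: f).
Proof.
move=> [B fB]; exists (nr a * B) => i.
by rewrite [(a *: f) i]/(a * f i) nrM ler_wpM2l ?nr_ge0.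
Qed.

Lemma supnZ (i0 : I) a f : bounded f -> supn (a *: f) = nr a * supn f.
Proof.
apply: (homogeneous_of_le (P := bounded)); first exact: boundedZ.
  by move=> g bg; apply: le_trans (supn_ge i0 bg); exact: nr_ge0.
move=> b g bg; apply: (supn_le i0) => i; rewrite [(b *: g) i]/(b * g i) nrM.
by rewrite ler_wpM2l ?nr_ge0 // supn_ge.
Qed.

Lemma vanishing_lin a f g : vanishing f -> vanishing g -> vanishing (a *: f + g).
Proof.
move=> vf vg eps e0.
have na1 : 0 < nr a + 1 by rewrite ltr_wpDl ?nr_ge0.
have [|s fs] := vf (eps / 2 / (nr a + 1)); first by rewrite !divr_gt0.
have [|t gt] := vg (eps / 2); first by rewrite divr_gt0.
exists (s ++ t) => i; rewrite mem_cat negb_or => /andP[/fs fi /gt gi].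
apply: le_lt_trans (nrD _ _ _) _; rewrite [ltRHS]splitr ler_ltD //.
rewrite [(a *: f) i]/(a * f i) nrM.
apply: (@le_trans _ _ ((nr a + 1) * (eps / 2 / (nr a + 1)))).
  by apply: ler_pM; rewrite ?nr_ge0 ?(ltW fi) ?lerDl.
by rewrite mulrC divfK // gt_eqF.
Qed.

Lemma vanishing_closed f :
  (forall eps, 0 < eps -> exists2 g, vanishing g & forall i, nr (f i - g i) <= eps) ->
  vanishing f.
Proof.
move=> fg eps e0; have e20 : 0 < eps / 2 by rewrite divr_gt0.
have [g vg fge] := fg _ e20; have [s gs] := vg _ e20; exists s => i /gs gi.
rewrite -[f i](subrK (g i)) (le_lt_trans (nrD _ _ _)) //.
by rewrite [ltRHS]splitr ler_ltD.
Qed.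

End SupNorm.

Section TailSpace.
Context (R : realType) (K : numFieldType) (sc : scalars R K) (J : eqType).
Local Notation nr := (nr sc).
Context (gen : nat -> J -> K) (spt : nat -> seq J) (piv : nat -> J).
Hypothesis gen_spt : forall k i, i \notin spt k -> gen k i = 0.
Hypothesis gen_piv : forall k, gen k (piv k) != 0.
Implicit Types u v : nat * J -> K.

(** A coefficient sequence a for which the series of the a_j gen_j converges in
    c_0(J) is represented by its tails: u (k, i) is the value at i of the sum of
    the a_j gen_j over j >= k.  These functions u form a closed subspace of
    c_0(nat * J). *)
Definition tail_carrier : set (nat * J -> K) :=
  [set u | vanishing sc u /\
    forall k, exists a : K, forall i, u (k, i) - u (k.+1, i) = a * gen k i].

Fact tail0 : tail_carrier 0.
Proof.
split; first by move=> e e0; exists [::] => i _; rewrite nr0.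
by move=> k; exists 0 => i; rewrite mul0r subr0.
Qed.

Fact tail_lin a u v : tail_carrier u -> tail_carrier v -> tail_carrier (a *: u + v).
Proof.
move=> [vu du] [vv dv]; split; first exact: vanishing_lin.
move=> k; have [b bE] := du k; have [c cE] := dv k; exists (a * b + c) => i.
have E p : (a *: u + v) p = a * u p + v p by [].
by rewrite !E mulrDl -cE -mulrA -bE; ring.
Qed.

Fact tail_bounded u : tail_carrier u -> bounded sc u.
Proof. by move=> [/vanishing_bounded]. Qed.

(** In a uniform limit the difference of consecutive tails remains on the line
    of gen k, since proportionality to gen k is detected by the vanishing of the
    2 by 2 minors with the column piv k. *)
Fact tail_closed u : (forall eps, 0 < eps -> exists2 g, tail_carrier g &
  forall i, nr (u i - g i) <= eps) -> tail_carrier u.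
Proof.
move=> uc; split.
  by apply: vanishing_closed => e /uc[g [vg _] ug]; exists g.
move=> k; exists ((u (k, piv k) - u (k.+1, piv k)) / gen k (piv k)) => i.
apply: (mulIf (gen_piv k)); rewrite mulrAC divfK //.
apply/eqP; rewrite -subr_eq0; apply/eqP.
set p := piv k.
apply: (@nr_small_eq0 _ _ sc _ (2 * (nr (gen k p) + nr (gen k i)))).
  by rewrite mulr_ge0 // addr_ge0 // nr_ge0.
move=> e e0; have [g [_ dg] ug] := uc e e0; have [a aE] := dg k.
pose d j := (u (k, j) - g (k, j)) - (u (k.+1, j) - g (k.+1, j)).
have dE j : u (k, j) - u (k.+1, j) = a * gen k j + d j by rewrite -aE /d; ring.
have dle j : nr (d j) <= 2 * e.
  by rewrite mulr_natl mulr2n; apply: le_trans (nrB _ _ _) _; exact: lerD.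
rewrite !dE (_ : _ - _ = d i * gen k p - d p * gen k i); last by ring.
apply: le_trans (nrB _ _ _) _; rewrite !nrM mulrAC mulrDr.
by apply: lerD; apply: ler_wpM2r; rewrite ?nr_ge0.
Qed.

Fact tail_supnD u v : tail_carrier u -> tail_carrier v ->
  supn sc (u + v) <= supn sc u + supn sc v.
Proof. by move=> /tail_bounded bu /tail_bounded bv; exact: (supnD (0%N, piv 0%N)). Qed.

Fact tail_supnZ a u : tail_carrier u -> supn sc (a *: u) = nr a * supn sc u.
Proof. by move=> /tail_bounded bu; exact: (supnZ (0%N, piv 0%N)). Qed.

Fact tail_supn_ge u p : tail_carrier u -> nr (u p) <= supn sc u.
Proof. by move=> /tail_bounded; exact: supn_ge. Qed.

Fact tail_supn_le u B : tail_carrier u -> 0 <= B -> (forall p, nr (u p) <= B) ->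
  supn sc u <= 1 * B.
Proof. by move=> _ _ uB; rewrite mul1r; exact: (supn_le (0%N, piv 0%N)). Qed.

Definition tail_fspace : fspace sc (nat * J)%type :=
  FSpace tail0 tail_lin tail_supnD tail_supnZ tail_supn_ge tail_supn_le tail_closed.

Local Notation X := (felt tail_fspace).

Lemma tail_diff (x : X) k : exists a : K, forall i,
  fval x (k, i) - fval x (k.+1, i) = a * gen k i.
Proof. by have [] := carrier_fval x. Qed.

Lemma tail_vanishing (x : X) : vanishing sc (fval x).
Proof. by have [] := carrier_fval x. Qed.

Lemma tail_norm_le (x : X) B : (forall i, nr (fval x i) <= B) -> fnorm x <= B.
Proof. exact: (supn_le (0%N, piv 0%N)). Qed.

(** The tails of the j-th unit coefficient sequence. *)
Definition tail_fun (j : nat) : nat * J -> K :=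
  fun p => if (p.1 <= j)%N then gen j p.2 else 0.

Fact tail_fun_in j : tail_fun j \in carrier_pred tail_fspace.
Proof.
apply/carrier_predP; split.
  move=> e e0; exists [seq (k, i) | k <- iota 0 j.+1, i <- spt j] => -[k i] ki.
  rewrite /tail_fun /=; case: leqP => kj; last by rewrite nr0.
  rewrite gen_spt ?nr0 //; apply: contra ki => ki.
  by apply/allpairsP; exists (k, i); rewrite mem_iota.
move=> k; exists (k == j)%:R => i; rewrite /tail_fun /=.
case: (ltngtP k j) => [kj|kj|->]; rewrite ?mul0r ?mul1r ?subr0 ?subrr //.
Qed.

Definition tail_basis (j : nat) : X := Felt (tail_fun_in j).

(** Removing the first n terms of the series turns the tail from k on into the
    tail that starts at the later of k and n. *)
Lemma tail_partial (x : X) (a : nat -> K) n k i :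
  (forall k i, fval x (k, i) - fval x (k.+1, i) = a k * gen k i) ->
  fval x (k, i) - fval (series (fun j => a j *: tail_basis j) n) (k, i) =
  fval x (maxn k n, i).
Proof.
move=> xa; elim: n => [|n IH].
  by rewrite /series /= big_geq // fval0 subr0 maxn0.
rewrite seriesSr fvalD opprD addrA.
rewrite IH fvalZ [fval (tail_basis n) _]/(tail_fun n _) /tail_fun /=; case: leqP => kn.
  by rewrite -xa opprB addrCA subrr addr0 (maxn_idPr _) // leqW.
by rewrite mulr0 subr0 (maxn_idPl kn).
Qed.

Lemma series_diff (a : nat -> K) n k i :
  let sn := series (fun j => a j *: tail_basis j) n in
  fval sn (k, i) - fval sn (k.+1, i) = if (k < n)%N then a k * gen k i else 0.
Proof.
elim: n => [|n /= IH]; first by rewrite /series /= big_geq // subr0.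
rewrite seriesSr !fvalD opprD addrACA [X in X + _]IH !fvalZ -mulrBr ltnS.
rewrite ![fval (tail_basis n) _]/(tail_fun n _) /tail_fun /=.
case: (ltngtP k n) => [kn|kn|->]; rewrite ?subrr ?subr0 ?mulr0 ?addr0 ?add0r //.
Qed.

(** The remainders of the expansion of x are tails of x, which tend to 0 since
    x is in c_0(nat * J).  Conversely the k-th coefficient is determined by the
    difference of two consecutive tails, because gen k is not 0. *)
Lemma tail_schauder : schauder_basis tail_basis.
Proof.
move=> x; have /choice[a xa] := tail_diff x; exists a; split.
  apply/cvgrPdist_le => e /(emb_nr_gt0 sc)[eE e0].
  have [s xs] := tail_vanishing x e0.
  exists (\max_(p <- s) p.1).+1 => // n /= sn.
  rewrite feltE eE (emb_mono sc); apply: tail_norm_le => -[k i].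
  rewrite fvalB (tail_partial _ _ _ xa); apply/ltW/xs; apply/negP => ks.
  have := @leq_bigmax_seq _ s xpredT (fun p => p.1) _ ks isT.
  by rewrite /= leqNgt (leq_trans sn) // leq_maxr.
move=> b bx; apply/funext => k; apply: (mulIf (gen_piv k)); rewrite -xa.
apply/eqP; rewrite -subr_eq0; apply/eqP; apply: (@nr_small_eq0 _ _ sc _ 2) => // eps e0.
have e0' : 0 < emb sc eps by rewrite -(rmorph0 (emb sc)) (emb_lt sc).
have /cvgrPdist_le /(_ _ e0') [N _ xN] := bx.
pose n := maxn N k.+1; have := xN n (leq_maxl _ _); rewrite /= feltE (emb_mono sc) => xn.
pose sn := series (fun j => b j *: tail_basis j) n.
have snE : fval sn (k, piv k) - fval sn (k.+1, piv k) = b k * gen k (piv k).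
  by rewrite series_diff leq_maxr.
rewrite -snE (_ : _ - _ = (fval x (k, piv k) - fval sn (k, piv k)) -
  (fval x (k.+1, piv k) - fval sn (k.+1, piv k))); last by ring.
rewrite -!fvalB; apply: le_trans (nrB _ _ _) _.
by rewrite mulr_natl mulr2n; apply: lerD; apply: le_trans (fnorm_ge _ _) xn.
Qed.

End TailSpace.

(** * A strictly convex norm *)
Lemma half_ge0 (R : numFieldType) m : 0 <= 2 ^- m :> R.
Proof. by rewrite invr_ge0 exprn_ge0. Qed.

Section StrictNorm.
Context (R : realType) (K : numFieldType) (sc : scalars R K) (J : eqType).
Local Notation nr := (nr sc).
Context (en : nat -> J).
Hypothesis en_surj : forall i, exists n, en n = i.
Implicit Types f g : J -> K.

Lemma le_of_sqr (a b : R) : 0 <= b -> a ^+ 2 <= b ^+ 2 -> a <= b.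
Proof.
move=> b0 ab; case: (lerP a 0) => [/le_trans->//|/ltW a0].
by rewrite -(ler_pXn2r (n := 2)) ?nnegrE.
Qed.

(** With hyp an l^2 sum can be built one coordinate at a time. *)
Definition hyp (a b : R) := Num.sqrt (a ^+ 2 + b ^+ 2).

Lemma hyp2 a b : hyp a b ^+ 2 = a ^+ 2 + b ^+ 2.
Proof. by rewrite sqr_sqrtr // addr_ge0 // sqr_ge0. Qed.

Lemma hyp_ge0 a b : 0 <= hyp a b.
Proof. exact: sqrtr_ge0. Qed.

Lemma hyp_le a b c : 0 <= c -> a ^+ 2 + b ^+ 2 <= c ^+ 2 -> hyp a b <= c.
Proof. by move=> c0 h; apply: le_of_sqr => //; rewrite hyp2. Qed.

Lemma hyp_ge a b : 0 <= a -> a <= hyp a b.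
Proof.
by move=> a0; apply: le_of_sqr; rewrite ?hyp_ge0 // hyp2 lerDl sqr_ge0.
Qed.

Lemma hyp_mono a b c d : 0 <= a -> a <= c -> 0 <= b -> b <= d -> hyp a b <= hyp c d.
Proof.
move=> a0 ac b0 bd; apply: hyp_le; first exact: hyp_ge0.
by rewrite hyp2 lerD // ler_pXn2r ?nnegrE // ?(le_trans _ ac) // (le_trans _ bd).
Qed.

Lemma hyp_tri a b c d : hyp (a + c) (b + d) <= hyp a b + hyp c d.
Proof.
have p0 := hyp_ge0 a b; have q0 := hyp_ge0 c d.
apply: hyp_le; first exact: addr_ge0.
have pE := hyp2 a b; have qE := hyp2 c d.
move: (hyp a b) (hyp c d) p0 q0 pE qE => p q p0 q0 pE qE.
have cs : a * c + b * d <= p * q.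
  apply: le_trans (ler_norm _) _.
  apply: le_of_sqr; rewrite ?mulr_ge0 // real_normK ?num_real //.
  rewrite exprMn pE qE -subr_ge0.
  by rewrite (_ : _ - _ = (a * d - b * c) ^+ 2) ?sqr_ge0 //; ring.
have -> : (a + c) ^+ 2 + (b + d) ^+ 2 =
  (a ^+ 2 + b ^+ 2) + (c ^+ 2 + d ^+ 2) + (a * c + b * d) *+ 2 by ring.
by rewrite -pE -qE sqrrD [leRHS]addrAC lerD2l lerMn2r.
Qed.

Lemma hyp_scale k a b : 0 <= k -> hyp (k * a) (k * b) = k * hyp a b.
Proof.
by move=> k0; rewrite /hyp !exprMn -mulrDr sqrtrM ?sqr_ge0 // sqrtr_sqr ger0_norm.
Qed.

(** The square of part_norm n f is the square of the supremum norm of f plus the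
    first n terms of the series of the 4^-m |f (en m)|^2. *)
Fixpoint part_norm n f : R :=
  if n is m.+1 then hyp (part_norm m f) (2 ^- m * nr (f (en m))) else supn sc f.

Lemma supn_ge0 f : bounded sc f -> 0 <= supn sc f.
Proof. by move=> bf; apply: le_trans (supn_ge (en 0) bf); exact: nr_ge0. Qed.

Lemma part_ge0 n f : bounded sc f -> 0 <= part_norm n f.
Proof. by case: n => [|n] bf; [exact: supn_ge0|exact: hyp_ge0]. Qed.

Lemma part_homo f n m : bounded sc f -> (n <= m)%N -> part_norm n f <= part_norm m f.
Proof.
move=> bf; elim: m => [|m IH]; first by rewrite leqn0 => /eqP->.
rewrite leq_eqVlt => /predU1P[->//|]; rewrite ltnS => /IH /le_trans; apply.
exact/hyp_ge/part_ge0.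
Qed.

Lemma part_le n f : bounded sc f -> part_norm n f <= 2 * supn sc f.
Proof.
move=> bf; have s0 := supn_ge0 bf.
(* Since 4^-m <= 2^-m, the coefficients add up to at most 2 - 2 * 2^-n. *)
have H : part_norm n f ^+ 2 <= supn sc f ^+ 2 * (3 - 2 * 2 ^- n).
  elim: n => [|n IH] /=; first by rewrite expr0 invr1; lra.
  rewrite hyp2 (exprS 2 n) invfM [2 * (2^-1 * _)]mulrA mulfV ?pnatr_eq0 ?mul1r //.
  have h : (2 ^- n * nr (f (en n))) ^+ 2 <= 2 ^- n * supn sc f ^+ 2.
    rewrite exprMn; apply: ler_pM; rewrite ?sqr_ge0 //.
      by rewrite expr2 ler_piMl ?half_ge0 // invf_le1 ?exprn_ege1 ?exprn_gt0 // ler1n.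
    by rewrite ler_pXn2r ?nnegrE ?nr_ge0 ?supn_ge.
  by apply: le_trans (lerD IH h) _; rewrite -subr_ge0 le_eqVlt; apply/orP; left; apply/eqP; ring.
apply: le_of_sqr; first exact: mulr_ge0.
apply: le_trans H _; rewrite exprMn mulrC ler_wpM2r ?sqr_ge0 //.
have := half_ge0 R n; lra.
Qed.

Lemma boundedD f g : bounded sc f -> bounded sc g -> bounded sc (f + g).
Proof.
move=> [B fB] [C gC]; exists (B + C) => i.
by apply: le_trans (nrD _ _ _) _; exact: lerD.
Qed.

Lemma partD n f g : bounded sc f -> bounded sc g ->
  part_norm n (f + g) <= part_norm n f + part_norm n g.
Proof.
move=> bf bg; elim: n => [|n IH]; first exact: (supnD (en 0)).
apply: le_trans (hyp_tri _ _ _ _); apply: hyp_mono => //.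
- exact/part_ge0/boundedD.
- by rewrite mulr_ge0 ?nr_ge0 ?half_ge0.
- by rewrite -mulrDr ler_wpM2l ?half_ge0 // nrD.
Qed.

Lemma partZ n a f : bounded sc f -> part_norm n (a *: f) = nr a * part_norm n f.
Proof.
move=> bf; elim: n => [|n IH] /=; first exact: (supnZ (en 0)).
by rewrite IH -hyp_scale ?nr_ge0 // [(a *: f) _]/(a * f _) nrM mulrCA.
Qed.

(** The norm whose square is the squared supremum norm plus a squared Hilbert
    norm that separates points. *)
Definition rot_norm f : R := sup (range (part_norm ^~ f)).

Lemma rot_ge n f : bounded sc f -> part_norm n f <= rot_norm f.
Proof.
move=> bf; apply: ub_le_sup; last by exists n.
by exists (2 * supn sc f) => _ [m _ <-]; exact: part_le.
Qed.

Lemma rot_le f B : (forall n, part_norm n f <= B) -> rot_norm f <= B.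
Proof.
move=> fB; apply: ge_sup; first by exists (part_norm 0 f), 0%N.
by move=> _ [m _ <-].
Qed.

Lemma rotD f g : bounded sc f -> bounded sc g -> rot_norm (f + g) <= rot_norm f + rot_norm g.
Proof.
move=> bf bg; apply: rot_le => n; apply: le_trans (partD _ bf bg) _.
by apply: lerD; exact: rot_ge.
Qed.

Lemma rotZ a f : bounded sc f -> rot_norm (a *: f) = nr a * rot_norm f.
Proof.
apply: (@homogeneous_of_le _ _ sc _ (@bounded _ _ sc J) rot_norm) => [b g|g bg|b g bg].
- exact: boundedZ.
- exact: le_trans (part_ge0 0 bg) (rot_ge 0 bg).
- by apply: rot_le => n; rewrite partZ // ler_wpM2l ?nr_ge0 // rot_ge.
Qed.

Lemma rot_sup f i : bounded sc f -> nr (f i) <= rot_norm f.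
Proof. by move=> bf; apply: le_trans (supn_ge i bf) (rot_ge 0 bf). Qed.

Lemma rot_le_sup f B : bounded sc f -> (forall i, nr (f i) <= B) -> rot_norm f <= 2 * B.
Proof.
move=> bf fB; apply: rot_le => n; apply: le_trans (part_le n bf) _.
by rewrite ler_wpM2l // (supn_le (en 0)).
Qed.

(** For the supremum norm, 2 |f|^2 <= |f + g|^2 + |f - g|^2 by the triangle
    inequality; the Euclidean terms satisfy the parallelogram identity, which
    contributes the extra terms in g. *)
Lemma part_parallelogram n f g : bounded sc f -> bounded sc g ->
  part_norm n f ^+ 2 *+ 2 + (\sum_(i < n) (2 ^- i * nr (g (en i))) ^+ 2) *+ 2 <=
  part_norm n (f + g) ^+ 2 + part_norm n (f - g) ^+ 2.
Proof.
move=> bf bg; elim: n => [|n IH].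
  rewrite big_ord0 mul0rn addr0 /=.
  have bg' : bounded sc (- g) by rewrite -scaleN1r; exact: boundedZ.
  have bp := boundedD bf bg; have bm := boundedD bf bg'.
  have : supn sc ((f + g) + (f - g)) <= supn sc (f + g) + supn sc (f - g).
    exact: (supnD (en 0)).
  rewrite (_ : _ + _ = 2 *: f); last first.
    by rewrite addrACA subrr addr0 scaler_nat.
  rewrite (supnZ (en 0)) // -(rmorph_nat (emb sc)) nr_emb normr_nat.
  have := supn_ge0 bf; have := supn_ge0 bp; have := supn_ge0 bm.
  move: (supn sc f) (supn sc (f + g)) (supn sc (f - g)) => a b c c0 b0 a0 h.
  have h2 : (2 * a) ^+ 2 <= (b + c) ^+ 2 by rewrite ler_pXn2r // nnegrE ?mulr_ge0 ?addr_ge0.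
  have : 0 <= (b - c) ^+ 2 by exact: sqr_ge0.
  nra.
rewrite big_ord_recr /= !hyp2 !exprMn.
have := nr_parallelogram sc (f (en n)) (g (en n)).
rewrite -[f (en n) + _]/((f + g) (en n)) -[f (en n) - _]/((f - g) (en n)).
have := half_ge0 R n; move: IH; set S := \sum_(i < n) _; move: S (2 ^- n) => S c.
move: (part_norm n _) (part_norm n _) (part_norm n _) => p q r IH c0 E.
have -> : c ^+ 2 * nr ((f + g) (en n)) ^+ 2 =
  c ^+ 2 * ((nr (f (en n)) ^+ 2 + nr (g (en n)) ^+ 2) *+ 2 - nr ((f - g) (en n)) ^+ 2).
  by rewrite -E; ring.
lra.
Qed.

(** Strict convexity.  With r the norm of f, the parallelogram inequality leaves
    no room below r for the terms in g: each of them would force the norm of f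
    to be strictly smaller than r. *)
Lemma rot_strict f g : bounded sc f -> bounded sc g ->
  rot_norm (f + g) <= rot_norm f -> rot_norm (f - g) <= rot_norm f -> g = 0.
Proof.
move=> bf bg hp hm; apply/funext => i; have [k <-] := en_surj i.
apply: (nr0_eq0 (sc := sc)); set r := rot_norm f in hp hm.
have bg' : bounded sc (- g) by rewrite -scaleN1r; exact: boundedZ.
have bp := boundedD bf bg; have bm := boundedD bf bg'.
have r0 : 0 <= r := le_trans (part_ge0 0 bf) (rot_ge 0 bf).
pose c := 2 ^- k * nr (g (en k)).
have c0 : 0 <= c by rewrite mulr_ge0 ?nr_ge0 ?half_ge0.
have H n : part_norm n f ^+ 2 <= r ^+ 2 - c ^+ 2.
  have nm : (n <= maxn n k.+1)%N := leq_maxl _ _.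
  have km : (k < maxn n k.+1)%N := leq_maxr _ _.
  set m := maxn n k.+1 in nm km.
  have h1 : part_norm n f ^+ 2 <= part_norm m f ^+ 2.
    by rewrite ler_pXn2r ?nnegrE ?part_ge0 // part_homo.
  have h2 := part_parallelogram m bf bg.
  have h3 : c ^+ 2 <= \sum_(i < m) (2 ^- i * nr (g (en i))) ^+ 2.
    rewrite (bigD1 (Ordinal km)) //= lerDl sumr_ge0 // => j _; exact: sqr_ge0.
  have h4 : part_norm m (f + g) ^+ 2 <= r ^+ 2.
    by rewrite ler_pXn2r ?nnegrE ?part_ge0 // (le_trans (rot_ge _ bp)).
  have h5 : part_norm m (f - g) ^+ 2 <= r ^+ 2.
    by rewrite ler_pXn2r ?nnegrE ?part_ge0 // (le_trans (rot_ge _ bm)).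
  lra.
have rc0 : 0 <= r ^+ 2 - c ^+ 2 := le_trans (sqr_ge0 _) (H 0%N).
have : r <= Num.sqrt (r ^+ 2 - c ^+ 2).
  by apply: rot_le => n; apply: le_of_sqr; rewrite ?sqrtr_ge0 // sqr_sqrtr.
move=> rle; have h : r ^+ 2 <= r ^+ 2 - c ^+ 2.
  by rewrite -[leRHS]sqr_sqrtr // ler_pXn2r ?nnegrE ?sqrtr_ge0.
have /eqP : c ^+ 2 = 0 by apply/eqP; rewrite eq_le sqr_ge0 andbT; lra.
rewrite sqrf_eq0 mulf_eq0 invr_eq0 expf_eq0 pnatr_eq0 andbF /= => /eqP.
by [].
Qed.

Section RotSpace.
Context (P : set (J -> K)).
Hypothesis P0 : P 0.
Hypothesis P_lin : forall a f g, P f -> P g -> P (a *: f + g).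
Hypothesis P_bounded : forall f, P f -> bounded sc f.
Hypothesis P_closed : forall f, (forall eps, 0 < eps ->
  exists2 g, P g & forall i, nr (f i - g i) <= eps) -> P f.

Definition rot_fspace : fspace sc J := @FSpace _ _ sc _ P rot_norm P0 P_lin
  (fun f g Pf Pg => rotD (P_bounded Pf) (P_bounded Pg))
  (fun a f Pf => rotZ a (P_bounded Pf))
  (fun f i Pf => rot_sup i (P_bounded Pf))
  2 (fun f B Pf _ fB => rot_le_sup (P_bounded Pf) fB) P_closed.

End RotSpace.
End StrictNorm.

(** * Sign patterns of quadratic functions *)

(** Letters are vectors of F_2^4.  Tones are vectors of F_2^5, one coefficient
    for each monomial of quad. *)
Definition letter := (bool * bool * bool * bool)%type.
Definition tone := (letter * bool)%type.

Definition dot (a b : letter) : bool :=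
  let: (a1, a2, a3, a4) := a in let: (b1, b2, b3, b4) := b in
  (a1 && b1 (+) a2 && b2) (+) (a3 && b3 (+) a4 && b4).

(** The quadratic monomials in four variables, except x3 x4, which is twist.  The
    six monomials are linearly independent modulo affine functions. *)
Definition quad (v : tone) (x : letter) : bool :=
  let: (v1, v2, v3, v4, v5) := v in let: (x1, x2, x3, x4) := x in
  (v1 && (x1 && x2) (+) v2 && (x1 && x3)) (+)
  ((v3 && (x1 && x4) (+) v4 && (x2 && x3)) (+) v5 && (x2 && x4)).

Definition twist (x : letter) : bool := let: (_, _, x3, x4) := x in x3 && x4.

Definition xorl (a b : letter) : letter :=
  let: (a1, a2, a3, a4) := a in let: (b1, b2, b3, b4) := b in
  (a1 (+) b1, a2 (+) b2, a3 (+) b3, a4 (+) b4).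

Definition xort (v w : tone) : tone := (xorl v.1 w.1, v.2 (+) w.2).

Definition letter0 : letter := (false, false, false, false).
Definition tone0 : tone := (letter0, false).

Lemma xorl_eq0 a b : (xorl a b == letter0) = (a == b).
Proof. by case: a b => [[[[] []] []] []] [[[[] []] []] []]. Qed.

Lemma xort_eq0 v w : (xort v w == tone0) = (v == w).
Proof. by case: v w => [v []] [w []]; rewrite !xpair_eqE xorl_eq0 //= ?andbF ?andbT. Qed.

Lemma dotC a b : dot a b = dot b a.
Proof.
by move: a b => [[[a1 a2] a3] a4] [[[b1 b2] b3] b4] /=;
  rewrite (andbC a1) (andbC a2) (andbC a3) (andbC a4).
Qed.

Lemma dot_xorl a b x : dot (xorl a b) x = dot a x (+) dot b x.
Proof.
move: a b x => [[[a1 a2] a3] a4] [[[b1 b2] b3] b4] [[[x1 x2] x3] x4] /=.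
by rewrite !andb_addl (addbACA (a1 && x1)) (addbACA (a3 && x3)) addbACA.
Qed.

Lemma quad_xort v w x : quad (xort v w) x = quad v x (+) quad w x.
Proof.
move: v w x => [[[[a1 a2] a3] a4] a5] [[[[b1 b2] b3] b4] b5] [[[x1 x2] x3] x4] /=.
rewrite !andb_addl (addbACA (a1 && _)) (addbACA (a3 && _)).
by rewrite (addbACA _ _ (a5 && _)) addbACA.
Qed.

Definition bits := [:: false; true].
(** A sum of 16 signs, in a form that computes. *)
Definition ctally (f : letter -> bool) : int :=
  foldr (fun a s => foldr (fun b s => foldr (fun c s => foldr (fun d s =>
    (if f (a, b, c, d) then -1 else 1) + s) s bits) s bits) s bits) 0 bits.

Lemma sum_bits (M : nmodType) (F : bool -> M) : \sum_b F b = F false + F true.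
Proof. by rewrite (bigD1 false) //= (big_pred1 true) //; case. Qed.

Section SignSums.
Context (K : numFieldType).
Local Notation sg b := ((-1) ^+ (nat_of_bool b) : K).

Lemma sum_letter (M : nmodType) (F : letter -> M) :
  \sum_x F x = \sum_a \sum_b \sum_c \sum_d F (a, b, c, d).
Proof. by rewrite !pair_bigA /=; apply: eq_bigr => -[[[]]]. Qed.

Lemma sum_sg (f : letter -> bool) : \sum_x sg (f x) = (ctally f)%:~R.
Proof.
rewrite sum_letter !sum_bits /ctally /= !rmorphD /= rmorph0 addr0 -!addrA.
have E b : (if b then -1 else 1 : int)%:~R = sg b by case: b; rewrite ?rmorphN1.
by rewrite !E.
Qed.

Lemma sum_sg_dot (z : letter) : \sum_x sg (dot z x) = 16 * (z == letter0)%:R.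
Proof. by rewrite sum_sg; case: z => [[[[] []] []] []]; rewrite ?mulr0 ?mulr1. Qed.

(** A nonzero alternating form in four variables over F_2 has rank 2 or 4, and
    the corresponding sums of signs are 0, 4 or 8 in absolute value, whatever
    the linear part. *)
Lemma sum_sg_quad (u : letter) (v : tone) : v != tone0 ->
  `|\sum_x sg (dot u x (+) quad v x)| <= 8.
Proof.
move=> v0; rewrite sum_sg -intr_norm (_ : 8 = (8 : int)%:~R) // ler_int.
by move: u v v0 => [[[[] []] []] []] [[[[[] []] []] []] []].
Qed.

(** The quadratic part contains the monomial twist, hence is nonzero for every
    tone v. *)
Lemma sum_sg_twist (u : letter) (v : tone) :
  `|\sum_x sg (twist x (+) (dot u x (+) quad v x))| <= 8.
Proof.
rewrite sum_sg -intr_norm (_ : 8 = (8 : int)%:~R) // ler_int.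
by move: u v => [[[[] []] []] []] [[[[[] []] []] []] []].
Qed.

End SignSums.

(** * Words *)
Fixpoint words (n : nat) : seq (seq letter) :=
  if n is m.+1 then [seq x :: w | x <- enum {: letter}, w <- words m] else [:: [::]].

Lemma mem_words n w : (w \in words n) = (size w == n).
Proof.
elim: n w => [|n IH] [|x w] //=.
  by apply/allpairsP => -[[y z]] /= [].
rewrite eqSS -IH; apply/allpairsP/idP => [[[y z]] /= [_ zw [_ ->]] //|ww].
by exists (x, w); rewrite mem_enum.
Qed.

Lemma size_words n w : w \in words n -> size w = n.
Proof. by rewrite mem_words => /eqP. Qed.

Lemma uniq_words n : uniq (words n).
Proof.
elim: n => //= n IH; apply: allpairs_uniq => //; first exact: enum_uniq.
by move=> [x w] [y z] _ _ /= [-> ->].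
Qed.

Section WordSums.
Context (K : numFieldType).

Lemma sum_words0 (F : seq letter -> K) : \sum_(w <- words 0) F w = F [::].
Proof. by rewrite big_seq1. Qed.

Lemma sum_wordsS n (F : seq letter -> K) :
  \sum_(w <- words n.+1) F w = \sum_x \sum_(w <- words n) F (x :: w).
Proof. by rewrite /= big_allpairs_dep big_enum. Qed.

Lemma sum_words1 n : \sum_(w <- words n) 1 = 16 ^+ n :> K.
Proof.
elim: n => [|n IH]; first by rewrite sum_words0.
rewrite sum_wordsS (eq_bigr (fun=> 16 ^+ n)); last by move=> x _.
by rewrite sumr_const !card_prod !card_bool exprS mulr_natl.
Qed.

Fixpoint wprod (f : letter -> letter -> K) (w u : seq letter) : K :=
  match w, u with x :: w', y :: u' => f x y * wprod f w' u' | _, _ => 1 end.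

(** Correlations of word products factor letter by letter: this turns the bounds
    for one letter into bounds that decay geometrically with the length. *)
Lemma sum_wprod2 n f g u u' : size u = n -> size u' = n ->
  \sum_(w <- words n) wprod f w u * wprod g w u' =
  \prod_(p <- zip u u') \sum_x f x p.1 * g x p.2.
Proof.
elim: n u u' => [|n IH] [|y u] [|y' u'] //=.
  by rewrite sum_words0 big_nil mulr1.
move=> [su] [su']; rewrite sum_wordsS big_cons /= mulr_suml; apply: eq_bigr => x _.
by rewrite -IH // mulr_sumr; apply: eq_bigr => w _; rewrite mulrACA.
Qed.

Lemma wprodT f w u : wprod f w u = wprod (fun x y => f y x) u w.
Proof. by elim: w u => [|x w IH] [|y u] //=; rewrite IH. Qed.

Lemma prod_delta (u u' : seq letter) (c : letter -> letter -> K) n :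
  size u = n -> size u' = n ->
  (forall x y, c x y = 16 * (x == y)%:R) ->
  \prod_(p <- zip u u') c p.1 p.2 = 16 ^+ n * (u == u')%:R.
Proof.
move=> + + cE; elim: n u u' => [|n IH] [|y u] [|y' u'] //=.
  by rewrite big_nil mulr1.
move=> [su] [su']; rewrite big_cons IH //= cE exprS eqseq_cons -mulnb natrM.
by rewrite mulrACA.
Qed.

Lemma prod_bound (u u' : seq letter) (c : letter -> letter -> K) n :
  size u = n -> size u' = n -> (forall x y, `|c x y| <= 8) ->
  `|\prod_(p <- zip u u') c p.1 p.2| <= 8 ^+ n.
Proof.
move=> + + cE; elim: n u u' => [|n IH] [|y u] [|y' u'] //=.
  by rewrite big_nil normr1.
move=> [su] [su']; rewrite big_cons normrM exprS.
by apply: ler_pM => //; exact: IH.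
Qed.

Local Notation sg b := ((-1) ^+ (nat_of_bool b) : K).

Lemma sgK (b : bool) : sg b * sg b = 1.
Proof. by case: b; rewrite ?mulr1 ?mulrNN ?mulr1. Qed.

Lemma norm_sg (b : bool) : `|sg b| = 1.
Proof. exact: normr_sign. Qed.

(** For each tone v, had _ _ v is a Hadamard matrix of order 16: the character
    table of F_2^4, with rows multiplied by the signs of quad v.  Matrices of
    different tones are mutually incoherent. *)
Definition had (x y : letter) (v : tone) : K := sg (dot y x (+) quad v x).
(** The additional sign makes thad incoherent with had even for equal tones, and
    it disappears from products of two entries in the same row. *)
Definition thad (x y : letter) (v : tone) : K := sg (twist x) * had x y v.

Lemma had_rows x x' v : \sum_y had x y v * had x' y v = 16 * (x == x')%:R.
Proof.
transitivity (sg (quad v x (+) quad v x') * \sum_y sg (dot (xorl x x') y)).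
  rewrite mulr_sumr; apply: eq_bigr => y _.
  by rewrite /had -!signr_addb dot_xorl !(dotC y) addbACA addbC.
rewrite sum_sg_dot xorl_eq0; case: (eqVneq x x') => [->|_]; last by rewrite !mulr0.
by rewrite addbb mul1r.
Qed.

Lemma had_mul x y y' v v' :
  had x y v * had x y' v' = sg (dot (xorl y y') x (+) quad (xort v v') x).
Proof. by rewrite -signr_addb addbACA dot_xorl quad_xort. Qed.

Lemma had_cols y y' v : \sum_x had x y v * had x y' v = 16 * (y == y')%:R.
Proof.
rewrite -xorl_eq0 -sum_sg_dot; apply: eq_bigr => x _.
by rewrite had_mul quad_xort addbb addbF.
Qed.

Lemma had_incoherent y y' v v' : v != v' ->
  `|\sum_x had x y v * had x y' v'| <= 8.
Proof.
rewrite -xort_eq0 => vv'; under eq_bigr do rewrite had_mul.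
exact: sum_sg_quad.
Qed.

Lemma thadE x y y' v v' : thad x y v * thad x y' v' = had x y v * had x y' v'.
Proof. by rewrite mulrACA sgK mul1r. Qed.

Lemma thad_incoherent y y' v v' : `|\sum_x had x y v * thad x y' v'| <= 8.
Proof.
under eq_bigr do rewrite mulrCA had_mul -signr_addb.
exact: sum_sg_twist.
Qed.

(** Distinct characters of F_2^5: one for sigma, and 16 others for tau, indexed
    by the first letter of the word.  They separate the families sigma and tau,
    and the words that differ by their first letter only. *)
Definition hsig (v : tone) : K := sg v.2.
Definition htau (b : letter) (v : tone) : K := sg (dot b v.1).

(** The first letter of w enters tau through htau only: the remaining letters
    are matched with those of u, which is one letter shorter than w. *)
Definition sigma (w u : seq letter) (v : tone) : K :=
  hsig v * wprod (fun x y => thad x y v) w u.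
Definition tau (w u : seq letter) (v : tone) : K :=
  if w is b :: w' then htau b v * wprod (fun x y => had x y v) w' u else 0.

Lemma sum_tone (M : nmodType) (F : tone -> M) : \sum_v F v = \sum_a \sum_b F (a, b).
Proof. by rewrite pair_bigA; apply: eq_bigr => -[]. Qed.

Lemma hsig2 : \sum_v hsig v * hsig v = 32.
Proof.
under eq_bigr do rewrite sgK.
by rewrite sumr_const !card_prod !card_bool.
Qed.

Lemma htau2 b b' : \sum_v htau b v * htau b' v = 32 * (b == b')%:R.
Proof.
rewrite sum_tone /htau /= -xorl_eq0.
rewrite (_ : 32 * _ = 16 * (xorl b b' == letter0)%:R + 16 * (xorl b b' == letter0)%:R).
  rewrite -!sum_sg_dot -big_split; apply: eq_bigr => a _ /=.
  by rewrite sum_bits -!signr_addb dot_xorl.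
by rewrite -mulrDl; congr (_ * _); rewrite -natrD.
Qed.

Lemma hsig_htau b : \sum_v hsig v * htau b v = 0.
Proof.
rewrite sum_tone big1 // => a _.
by rewrite sum_bits /hsig /= mul1r mulN1r subrr.
Qed.

Lemma norm_hsig v : `|hsig v| = 1. Proof. exact: norm_sg. Qed.
Lemma norm_htau b v : `|htau b v| = 1. Proof. exact: norm_sg. Qed.

Lemma norm_wprod f w u : (forall x y, `|f x y| = 1) -> `|wprod f w u| = 1.
Proof.
move=> f1; elim: w u => [|x w IH] [|y u] /=; rewrite ?normr1 //.
by rewrite normrM f1 IH mulr1.
Qed.

Lemma norm_sigma w u v : `|sigma w u v| = 1.
Proof.
rewrite normrM norm_hsig norm_wprod ?mulr1 // => x y.
by rewrite normrM !norm_sg mulr1.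
Qed.

Lemma norm_tau b w u v : `|tau (b :: w) u v| = 1.
Proof. by rewrite normrM norm_htau norm_wprod ?mulr1 // => x y; rewrite norm_sg. Qed.

Lemma thad_rows x x' v : \sum_y thad x y v * thad x' y v = 16 * (x == x')%:R.
Proof.
rewrite -(had_rows x x' v); case: (eqVneq x x') => [->|xx'].
  by apply: eq_bigr => y _; rewrite thadE.
rewrite had_rows (negPf xx') mulr0.
under eq_bigr do rewrite mulrACA.
by rewrite -mulr_sumr had_rows (negPf xx') !mulr0.
Qed.

Lemma mixed_rows x x' v :
  \sum_y thad x y v * had x' y v = 16 * (sg (twist x) * (x == x')%:R).
Proof.
under eq_bigr do rewrite -mulrA.
by rewrite -mulr_sumr had_rows mulrCA.
Qed.

Lemma sum_wprod_rows f g n w w' : size w = n -> size w' = n ->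
  \sum_(u <- words n) wprod f w u * wprod g w' u =
  \prod_(p <- zip w w') \sum_y f p.1 y * g p.2 y.
Proof.
move=> sw sw'; rewrite -(sum_wprod2 (fun y x => f x y) (fun y x => g x y) sw sw').
by apply: eq_bigr => u _; rewrite (wprodT f) (wprodT g).
Qed.

(** The next three lemmas say that, on level n, the functions sigma of the words
    of length n and tau of the words of length n + 1 form an orthogonal system:
    the word products take care of the letters, and the characters in v of the
    rest. *)
Lemma sigma_orth n w w' : size w = n -> size w' = n ->
  \sum_(u <- words n) \sum_v sigma w u v * sigma w' u v = 32 * 16 ^+ n * (w == w')%:R.
Proof.
move=> sw sw'; rewrite exchange_big /= -mulrA -hsig2 mulr_suml; apply: eq_bigr => v _.
under eq_bigr do rewrite mulrACA.
rewrite -mulr_sumr sum_wprod_rows //; congr (_ * _).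
by apply: (prod_delta (c := fun x x' => \sum_y thad x y v * thad x' y v)) sw sw' _ => x x';
  exact: thad_rows.
Qed.

Lemma tau_orth n w w' : size w = n.+1 -> size w' = n.+1 ->
  \sum_(u <- words n) \sum_v tau w u v * tau w' u v = 32 * 16 ^+ n * (w == w')%:R.
Proof.
case: w => [|b w] //; case: w' => [|b' w'] // [sw] [sw'].
rewrite exchange_big /= eqseq_cons -mulnb natrM mulrACA -htau2 mulr_suml.
apply: eq_bigr => v _.
under eq_bigr do rewrite mulrACA.
rewrite -mulr_sumr sum_wprod_rows //; congr (_ * _).
by apply: (prod_delta (c := fun x x' => \sum_y had x y v * had x' y v)) sw sw' _ => x x';
  exact: had_rows.
Qed.

Lemma sigma_tau_orth n w w' : size w = n -> size w' = n.+1 ->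
  \sum_(u <- words n) \sum_v sigma w u v * tau w' u v = 0.
Proof.
case: w' => [|b' w'] // sw [sw'].
rewrite exchange_big /=.
transitivity ((\sum_v hsig v * htau b' v) *
  \prod_(p <- zip w w') (16 * (sg (twist p.1) * (p.1 == p.2)%:R))); last first.
  by rewrite hsig_htau mul0r.
rewrite mulr_suml; apply: eq_bigr => v _.
under eq_bigr do rewrite mulrACA.
rewrite -mulr_sumr sum_wprod_rows //; congr (_ * _).
by apply: eq_bigr => p _; exact: mixed_rows.
Qed.

(** The reproducing kernels of the spans of the sigma and of the tau of level n.
    For equal tones both are multiples of the identity in the variable u. *)
Lemma sigma_kernel n u u' v : size u = n -> size u' = n ->
  \sum_(w <- words n) sigma w u v * sigma w u' v = 16 ^+ n * (u == u')%:R.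
Proof.
move=> su su'; under eq_bigr do rewrite mulrACA sgK mul1r.
rewrite sum_wprod2 //.
by apply: (prod_delta (c := fun y y' => \sum_x thad x y v * thad x y' v)) su su' _ => y y';
  under eq_bigr do rewrite thadE; exact: had_cols.
Qed.

Lemma tau_kernel n u u' v : size u = n -> size u' = n ->
  \sum_(w <- words n.+1) tau w u v * tau w u' v = 16 ^+ n.+1 * (u == u')%:R.
Proof.
move=> su su'; rewrite sum_wordsS exprS -mulrA.
under eq_bigr do under eq_bigr do rewrite /= mulrACA sgK mul1r.
have -> : 16 * (16 ^+ n * (u == u')%:R) = \sum_(x : letter) 16 ^+ n * (u == u')%:R :> K.
  by rewrite sumr_const !card_prod !card_bool mulr_natl.
apply: eq_bigr => b _; rewrite sum_wprod2 //.
by apply: (prod_delta (c := fun y y' => \sum_x had x y v * had x y' v)) su su' _ => y y';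
  exact: had_cols.
Qed.

(** For different tones, and between different levels, the kernels are small:
    each letter contributes at most 8 instead of 16. *)
Lemma sigma_incoherent n u u' v v' : size u = n -> size u' = n -> v != v' ->
  `|\sum_(w <- words n) sigma w u v * sigma w u' v'| <= 8 ^+ n.
Proof.
move=> su su' vv'; under eq_bigr do rewrite mulrACA.
rewrite -mulr_sumr !normrM !norm_hsig !mul1r sum_wprod2 //.
by apply: (prod_bound (c := fun y y' => \sum_x thad x y v * thad x y' v')) su su' _ => y y';
  under eq_bigr do rewrite thadE; exact: had_incoherent.
Qed.

Lemma norm_sum_letter (F : letter -> K) B : (forall x, `|F x| <= B) ->
  `|\sum_x F x| <= 16 * B.
Proof.
move=> FB; apply: le_trans (ler_norm_sum _ _ _) _.
apply: (le_trans (ler_sum _ (fun x _ => FB x))).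
by rewrite sumr_const !card_prod !card_bool mulr_natl.
Qed.

Lemma tau_incoherent n u u' v v' : size u = n -> size u' = n -> v != v' ->
  `|\sum_(w <- words n.+1) tau w u v * tau w u' v'| <= 16 * 8 ^+ n.
Proof.
move=> su su' vv'; rewrite sum_wordsS; apply: norm_sum_letter => b.
under eq_bigr do rewrite /= mulrACA.
rewrite -mulr_sumr !normrM !norm_htau !mul1r sum_wprod2 //.
by apply: (prod_bound (c := fun y y' => \sum_x had x y v * had x y' v')) su su' _ => y y';
  exact: had_incoherent.
Qed.

Lemma tau_sigma_incoherent n u u' v v' : size u = n -> size u' = n.+1 ->
  `|\sum_(w <- words n.+1) tau w u v * sigma w u' v'| <= 16 * 8 ^+ n.
Proof.
case: u' => [|y' u'] // su [su']; rewrite sum_wordsS; apply: norm_sum_letter => b.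
under eq_bigr do rewrite /= mulrACA (mulrCA (wprod _ _ _)).
rewrite -2!mulr_sumr !normrM norm_hsig norm_htau !norm_sg !mul1r sum_wprod2 //.
by apply: (prod_bound (c := fun y y' => \sum_x had x y v * thad x y' v')) su su' _ => y y'';
  exact: thad_incoherent.
Qed.

End WordSums.

(** * Atoms *)

(** The level of a site is the length of its word. *)
Notation site := (seq letter * tone)%type.

Section Atoms.
Context (K : numFieldType).

(** Consecutive levels are coupled: level n carries the sigma of the words of
    length n and the tau of the words of length n + 1. *)
Definition atom (w : seq letter) (i : site) : K :=
  if size i.1 == size w then sigma K w i.1 i.2
  else if size w == (size i.1).+1 then tau K w i.1 i.2 else 0.

Lemma atom_sigma w u v : size u = size w -> atom w (u, v) = sigma K w u v.
Proof. by rewrite /atom /= => ->; rewrite eqxx. Qed.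

Lemma atom_tau w u v : size w = (size u).+1 -> atom w (u, v) = tau K w u v.
Proof. by rewrite /atom /= => ->; rewrite (ltn_eqF (ltnSn _)) eqxx. Qed.

Lemma atom_far w u v : size u != size w -> size w != (size u).+1 -> atom w (u, v) = 0.
Proof. by rewrite /atom /= => /negPf-> /negPf->. Qed.

Lemma atom_le1 w i : `|atom w i| <= 1.
Proof.
rewrite /atom; case: eqP => _; first by rewrite norm_sigma.
case: eqP => [|_]; last by rewrite normr0.
by case: w => [|b w] // _; rewrite norm_tau.
Qed.

Definition level_avg (n : nat) (F : seq letter -> tone -> K) : K :=
  (32 * 16 ^+ n)^-1 * \sum_(u <- words n) \sum_v F u v.

(** The coordinate functional of atom w, computed on either of the two levels
    that support it. *)
Definition alpha_sigma (n : nat) (w : seq letter) (z : site -> K) : K :=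
  level_avg n (fun u v => sigma K w u v * z (u, v)).
Definition alpha_tau (n : nat) (w : seq letter) (z : site -> K) : K :=
  level_avg n (fun u v => tau K w u v * z (u, v)).

Lemma level_avgE n F G : (forall u v, size u = n -> F u v = G u v) ->
  level_avg n F = level_avg n G.
Proof.
move=> FG; congr (_ * _); apply: eq_big_seq => u /size_words su.
by apply: eq_bigr => v _; exact: FG.
Qed.

Let vol_neq0 n : 32 * 16 ^+ n != 0 :> K.
Proof. by rewrite mulf_neq0 ?expf_neq0 ?pnatr_eq0. Qed.

Lemma level_avg0 n : level_avg n (fun _ _ => 0) = 0.
Proof. by rewrite /level_avg big1 ?mulr0 // => u _; rewrite big1. Qed.

Lemma level_avg_le n F B : (forall u v, size u = n -> `|F u v| <= B) ->
  `|level_avg n F| <= B.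
Proof.
move=> FB; rewrite normrM normfV [`|32 * _|]ger0_norm ?mulr_ge0 ?exprn_ge0 //.
rewrite mulrC ler_pdivrMr ?mulr_gt0 ?exprn_gt0 //.
apply: le_trans (ler_norm_sum _ _ _) _.
have -> : B * (32 * 16 ^+ n) = \sum_(u <- words n) 32 * B.
  rewrite (eq_bigr (fun=> 32 * B * 1)); last by move=> u _; rewrite mulr1.
  by rewrite -mulr_sumr sum_words1 mulrA (mulrC B).
rewrite big_seq [leRHS]big_seq; apply: ler_sum => u /size_words su.
apply: le_trans (ler_norm_sum _ _ _) _.
apply: (le_trans (ler_sum _ (fun v _ => FB u v su))).
by rewrite sumr_const !card_prod !card_bool mulr_natl.
Qed.

Lemma alpha_sigma_atom n w w' : size w = n ->
  alpha_sigma n w (atom w') = (w == w')%:R.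
Proof.
move=> sw; case: (eqVneq (size w') n) => [sw'|sw'].
  rewrite /alpha_sigma (@level_avgE _ _ (fun u v => sigma K w u v * sigma K w' u v)).
    by rewrite /level_avg sigma_orth // mulKf.
  by move=> u v su; rewrite atom_sigma // su.
have /negPf-> : w != w' by apply: contraNneq sw' => <-; rewrite sw.
case: (eqVneq (size w') n.+1) => [sw''|sw''].
  rewrite /alpha_sigma (@level_avgE _ _ (fun u v => sigma K w u v * tau K w' u v)).
    by rewrite /level_avg sigma_tau_orth // mulr0.
  by move=> u v su; rewrite atom_tau // su.
rewrite -[RHS](level_avg0 n); apply: level_avgE => u v su.
by rewrite atom_far ?mulr0 // su // eq_sym.
Qed.

Lemma alpha_tau_atom n w w' : size w = n.+1 ->
  alpha_tau n w (atom w') = (w == w')%:R.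
Proof.
move=> sw; case: (eqVneq (size w') n.+1) => [sw'|sw'].
  rewrite /alpha_tau (@level_avgE _ _ (fun u v => tau K w u v * tau K w' u v)).
    by rewrite /level_avg tau_orth // mulKf.
  by move=> u v su; rewrite atom_tau // su.
have /negPf-> : w != w' by apply: contraNneq sw' => <-; rewrite sw.
case: (eqVneq (size w') n) => [sw''|sw''].
  rewrite /alpha_tau (@level_avgE _ _ (fun u v => sigma K w' u v * tau K w u v)).
    by rewrite /level_avg sigma_tau_orth // mulr0.
  by move=> u v su; rewrite atom_sigma ?su // mulrC.
rewrite -[RHS](level_avg0 n); apply: level_avgE => u v su.
by rewrite atom_far ?mulr0 // su // eq_sym.
Qed.

(** The coefficients, on the atoms of the words of length n + 1 and n, of the
    kernel at the site (u, v) for tau minus the kernel at (u, v) for sigma, each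
    divided by its value at (u, v). *)
Definition davie_words n := words n.+1 ++ words n.
Definition davie_coef n (u : seq letter) (v : tone) (w : seq letter) : K :=
  if size w == n.+1 then 16 ^- n.+1 * tau K w u v else - (16 ^- n * sigma K w u v).

Lemma sum_davie (M : lmodType K) n u v (F : seq letter -> M) :
  \sum_(w <- davie_words n) davie_coef n u v w *: F w =
  16 ^- n.+1 *: (\sum_(w <- words n.+1) tau K w u v *: F w)
  - 16 ^- n *: (\sum_(w <- words n) sigma K w u v *: F w).
Proof.
rewrite big_cat; congr (_ + _).
  rewrite scaler_sumr; apply: eq_big_seq => w /size_words sw.
  by rewrite /davie_coef sw eqxx scalerA.
rewrite scaler_sumr -sumrN; apply: eq_big_seq => w /size_words sw.
by rewrite /davie_coef sw (ltn_eqF (ltnSn _)) scalerA scaleNr.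
Qed.

Let half_pow n : 16 ^- n * 8 ^+ n = 2 ^- n :> K.
Proof.
have -> : 16 = 2 * 8 :> K by rewrite -natrM.
by rewrite exprMn invfM -mulrA mulVf ?mulr1 // expf_neq0 // pnatr_eq0.
Qed.

(** On level n the two normalized kernels cancel when the tones agree.  All the
    other values are bounded by incoherence; the factor 2 accounts for the two
    kernels on level n, and for the missing letter on level n - 1. *)
Lemma davie_small n u v i : size u = n ->
  `|\sum_(w <- davie_words n) davie_coef n u v w * atom w i| <= 2 * 2 ^- n.
Proof.
move=> su; rewrite [X in `|X|](sum_davie n u v (fun w => atom w i : K^o)).
case: i => u' v'.
have p2 m : 0 <= 2 ^- m :> K by rewrite invr_ge0 exprn_ge0.
have p16 m : `|16 ^- m| = 16 ^- m :> K by rewrite ger0_norm // invr_ge0 exprn_ge0.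
have half1 : 2 ^- n <= 2 * 2 ^- n :> K by rewrite mulr_natl mulr2n lerDl.
have sum0 m (c : seq letter -> K) : size u' != m -> m != (size u').+1 ->
    \sum_(w <- words m) c w *: (atom w (u', v') : K^o) = 0.
  move=> h1 h2; rewrite big_seq big1 // => w /size_words sw.
  by rewrite atom_far ?sw // scaler0.
have sumS m (c : seq letter -> K) : size u' = m ->
    \sum_(w <- words m) c w *: (atom w (u', v') : K^o) =
    \sum_(w <- words m) c w * sigma K w u' v'.
  by move=> h; apply: eq_big_seq => w /size_words sw; rewrite atom_sigma // sw.
have sumT m (c : seq letter -> K) : (size u').+1 = m ->
    \sum_(w <- words m) c w *: (atom w (u', v') : K^o) =
    \sum_(w <- words m) c w * tau K w u' v'.
  by move=> h; apply: eq_big_seq => w /size_words sw; rewrite atom_tau // sw.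
have bound16 m (z : K) : `|z| <= 16 * 8 ^+ m -> `|16 ^- m.+1 * z| <= 2 ^- m.
  move=> zB; rewrite normrM p16 -half_pow exprS invfM (mulrC 16^-1) -mulrA.
  by rewrite ler_pM2l ?invr_gt0 ?exprn_gt0 // mulrC ler_pdivrMr // mulrC.
have bound8 m (z : K) : `|z| <= 8 ^+ m -> `|16 ^- m * z| <= 2 ^- m.
  move=> zB; rewrite normrM p16 -half_pow.
  by rewrite ler_pM2l ?invr_gt0 ?exprn_gt0.
case: (eqVneq (size u') n.+1) => [su'|su1].
  rewrite (sumS n.+1) // (sum0 n) ?su' ?scaler0 ?subr0; [|lia|lia].
  by apply: le_trans half1; apply: bound16; exact: tau_sigma_incoherent.
case: (eqVneq (size u') n) => [su'|su2].
  rewrite (sumS n) // (sumT n.+1) ?su' //.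
  case: (eqVneq v v') => [<-|vv'].
    rewrite tau_kernel // sigma_kernel // /GRing.scale /= !mulKf ?expf_neq0 ?pnatr_eq0 //.
    by rewrite subrr normr0 mulr_ge0.
  apply: le_trans (ler_normB _ _) _; rewrite mulr_natl mulr2n lerD //.
    by apply: bound16; exact: tau_incoherent.
  by apply: bound8; exact: sigma_incoherent.
case: (eqVneq (size u').+1 n) => [su'|su3].
  rewrite (sumT n) // (sum0 n.+1) ?scaler0 ?sub0r; [|lia|lia].
  rewrite -su' normrN [leRHS](_ : _ = 2 ^- (size u')); last first.
    by rewrite exprS invfM mulrA divff ?mul1r // pnatr_eq0.
  apply: bound16; under eq_bigr do rewrite mulrC.
  by apply: tau_sigma_incoherent; rewrite // su'.
rewrite !sum0 ?scaler0 ?subr0 ?normr0 ?mulr_ge0 //; lia.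
Qed.

End Atoms.

(** * The spaces and the operator *)
Definition decode (n : nat) : seq letter := odflt [::] (unpickle n).

Lemma pickle_decode w : decode (pickle w) = w.
Proof. by rewrite /decode pickleK. Qed.

(** For 2^k <= j < 2^k.+1 the values schedule j run cyclically through 0, ...,
    k - 1.  As k * k <= 2^k for 4 <= k, there are at least k complete rounds. *)
Definition schedule (j : nat) : nat := (j - 2 ^ trunc_log 2 j) %% trunc_log 2 j.

Lemma leq_sqr_exp2 k : (4 <= k)%N -> (k * k <= 2 ^ k)%N.
Proof.
elim: k => // k IH; rewrite leq_eqVlt => /predU1P[<-//|]; rewrite ltnS => k4.
have := IH k4; rewrite expnS; nia.
Qed.

Lemma scheduleE k t c : (4 <= k)%N -> (t < k)%N -> (c < k)%N ->
  schedule (2 ^ k + t * k + c) = c.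
Proof.
move=> k4 tk ck; rewrite /schedule.
have -> : trunc_log 2 (2 ^ k + t * k + c) = k.
  apply: trunc_log_eq => //; rewrite -addnA leq_addr /=.
  have := leq_sqr_exp2 k4; rewrite expnS; nia.
by rewrite -addnA addKn modnMDl modn_small.
Qed.

Definition level_sites (n : nat) : seq site := [seq (u, v) | u <- words n, v <- enum {: tone}].

Lemma mem_level_sites n i : (i \in level_sites n) = (size i.1 == n).
Proof.
case: i => u v; rewrite -mem_words; apply/allpairsP/idP => /= [[[a b]] /= [aw _ [-> _]] //|uw].
by exists (u, v); rewrite mem_enum.
Qed.

Section Construction.
Context (R : realType) (K : numFieldType) (sc : scalars R K).
Local Notation nr := (nr sc).
Local Notation emb := (emb sc).

Definition gen (j : nat) : site -> K := atom K (decode (schedule j)).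

Definition gen_support (j : nat) : seq site :=
  let w := decode (schedule j) in level_sites (size w) ++ level_sites (size w).-1.

Fact gen_spt k i : i \notin gen_support k -> gen k i = 0.
Proof.
case: i => u v; rewrite mem_cat !mem_level_sites negb_or /= => /andP[h1 h2].
rewrite /gen atom_far //; apply: contra h2 => /eqP->.
by rewrite eqxx.
Qed.

Fact gen_piv k : gen k (decode (schedule k), tone0) != 0.
Proof.
by rewrite /gen atom_sigma // -normr_eq0 norm_sigma oner_neq0.
Qed.

Definition Xspace := tail_fspace sc gen_piv.
Local Notation X := (felt Xspace).

Definition Xbasis (j : nat) : X := tail_basis sc gen_spt gen_piv j.

Lemma XbasisE j k i : fval (Xbasis j) (k, i) = if (k <= j)%N then gen j i else 0.
Proof. by []. Qed.

(** The ratio 3/4 is smaller than 1, to make the operator compact, and larger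
    than the ratio 1/2 of davie_small, to keep the normalized traces bounded. *)
Definition weight (n : nat) : R := (3 / 4) ^+ n.

Lemma weight_gt0 n : 0 < weight n.
Proof. by rewrite exprn_gt0 // divr_gt0. Qed.

Lemma weight_le1 n : weight n <= 1.
Proof. by rewrite /weight exprn_ile1 //; lra. Qed.

Lemma weight_neq0 n : emb (weight n) != 0.
Proof. by rewrite fmorph_eq0 gt_eqF // weight_gt0. Qed.

Definition damp (f : site -> K) (i : site) : K := emb (weight (size i.1)) * f i.

Lemma nr_damp f i : nr (damp f i) = weight (size i.1) * nr (f i).
Proof. by rewrite nrM nr_emb ger0_norm // ltW // weight_gt0. Qed.

Lemma nr_weight_le n (z : K) : nr (emb (weight n) * z) <= nr z.
Proof.
by rewrite nrM nr_emb ger0_norm ?ler_piMl ?nr_ge0 ?weight_le1 // ltW // weight_gt0.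
Qed.

Lemma nr_damp_le f i : nr (damp f i) <= nr (f i).
Proof. exact: nr_weight_le. Qed.

(** The sum of the series represented by x, which is its tail from 0 on. *)
Definition tsum (x : X) (i : site) : K := fval x (0%N, i).

Lemma nr_tsum x i : nr (tsum x i) <= fnorm x.
Proof. exact: fnorm_ge. Qed.

(** The uniform closure of the range of the operator.  Identities between
    functionals on Y need to be checked on damped atoms only (Ycarrier_eq0). *)
Definition Ycarrier : set (site -> K) :=
  [set y | forall eps, 0 < eps ->
     exists x : X, forall i, nr (y i - damp (tsum x) i) <= eps].

Lemma damp_tsum_lin a x x' i :
  damp (tsum (a *: x + x')) i = a * damp (tsum x) i + damp (tsum x') i.
Proof. by rewrite /damp /tsum fvalD fvalZ; ring. Qed.

Fact Y0 : Ycarrier 0.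
Proof.
by move=> e e0; exists 0 => i; rewrite /damp /tsum fval0 mulr0 subrr nr0 ltW.
Qed.

Fact Ylin a f g : Ycarrier f -> Ycarrier g -> Ycarrier (a *: f + g).
Proof.
move=> Yf Yg e e0.
have a1 : 0 < nr a + 1 by rewrite ltr_wpDl ?nr_ge0.
have [|x fx] := Yf (e / 2 / (nr a + 1)); first by rewrite !divr_gt0.
have [|x' gx] := Yg (e / 2); first by rewrite divr_gt0.
exists (a *: x + x') => i; rewrite damp_tsum_lin [(a *: f + g) i]/(a * f i + g i).
rewrite opprD addrACA -mulrBr; apply: le_trans (nrD _ _ _) _.
rewrite [leRHS]splitr lerD // nrM.
apply: (@le_trans _ _ ((nr a + 1) * (e / 2 / (nr a + 1)))).
  by apply: ler_pM; rewrite ?nr_ge0 ?lerDl.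
by rewrite mulrC divfK // gt_eqF.
Qed.

Fact Ybounded f : Ycarrier f -> bounded sc f.
Proof.
move=> /(_ 1 ltr01)[x fx]; exists (1 + fnorm x) => i.
rewrite -[f i](subrK (damp (tsum x) i)); apply: le_trans (nrD _ _ _) _.
by apply: lerD => //; apply: le_trans (nr_damp_le _ _) (nr_tsum _ _).
Qed.

Fact Yclosed f : (forall eps, 0 < eps ->
  exists2 g, Ycarrier g & forall i, nr (f i - g i) <= eps) -> Ycarrier f.
Proof.
move=> fc e e0; have e20 : 0 < e / 2 by rewrite divr_gt0.
have [g Yg fg] := fc _ e20; have [x gx] := Yg _ e20; exists x => i.
by apply: le_trans (nr_tri _ _ (g i) _) _; rewrite [leRHS]splitr lerD.
Qed.

Definition site_enum (n : nat) : site := odflt ([::], tone0) (unpickle n).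

Fact site_enum_surj i : exists n, site_enum n = i.
Proof. by exists (pickle i); rewrite /site_enum pickleK. Qed.

Definition Yspace := rot_fspace site_enum Y0 Ylin Ybounded Yclosed.
Local Notation Y := (felt Yspace).

Fact damp_tsum_in x : damp (tsum x) \in carrier_pred Yspace.
Proof. by apply/carrier_predP => e e0; exists x => i; rewrite subrr nr0 ltW. Qed.

Definition damped_sum_fun (x : X) : Y := Felt (damp_tsum_in x).

Fact damped_sum_linear : linear damped_sum_fun.
Proof.
by move=> a x y; apply/val_inj/funext => i; exact: damp_tsum_lin.
Qed.

HB.instance Definition _ := GRing.isLinear.Build K X Y _ damped_sum_fun damped_sum_linear.
(** The compact operator that has no approximation by operators of finite rank. *)
Definition damped_sum : {linear X -> Y} := damped_sum_fun.

Lemma damped_sumE x i : fval (damped_sum x) i = damp (tsum x) i.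
Proof. by []. Qed.

Lemma Ynorm_le (y : Y) B : (forall i, nr (fval y i) <= B) -> fnorm y <= 2 * B.
Proof. exact: (rot_le_sup site_enum (Ybounded (carrier_fval y))). Qed.

Lemma damped_sum_bounded x : fnorm (damped_sum x) <= 2 * fnorm x.
Proof. by apply: Ynorm_le => i; apply: le_trans (nr_damp_le _ _) (nr_tsum _ _). Qed.

Lemma Y_strict (y z : Y) :
  fnorm (y + z) <= fnorm y -> fnorm (y - z) <= fnorm y -> z = 0.
Proof.
move=> h1 h2; apply/val_inj.
exact: (rot_strict site_enum_surj (Ybounded (carrier_fval y)) (Ybounded (carrier_fval z)) h1 h2).
Qed.

(** The partial sums of the expansion of x approximate tsum x, since the
    remainders are tails of x. *)
Lemma tsum_approx (x : X) eps : 0 < eps -> exists n (a : nat -> K),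
  forall i, nr (tsum x i - \sum_(j < n) a j * gen j i) <= eps.
Proof.
move=> e0; have /choice[a xa] := tail_diff x; have [s xs] := tail_vanishing x e0.
pose n := (\max_(p <- s) p.1).+1; exists n, a => i.
have := tail_partial gen_spt n 0 i xa; rewrite max0n => E.
have -> : \sum_(j < n) a j * gen j i =
    fval (series (fun j => a j *: tail_basis sc gen_spt gen_piv j) n) (0%N, i).
  rewrite /series /= fval_sum big_mkord; apply: eq_bigr => j _.
  by rewrite fvalZ.
rewrite E; apply/ltW/xs; apply/negP => ks.
have := @leq_bigmax_seq _ s xpredT (fun p => p.1) _ ks isT.
by rewrite /= ltnn.
Qed.

End Construction.

(** * Liftings and normalized traces *)

Section Lifting.
Context (R : realType) (K : numFieldType) (sc : scalars R K).
Local Notation nr := (nr sc).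
Local Notation emb := (emb sc).
Local Notation X := (felt (Xspace sc)).
Local Notation Y := (felt (Yspace sc)).
Local Notation atom := (atom K).

(** A preimage of atom w under tsum, spread evenly over k occurrences of w in the
    block of positions from 2^k on. *)
Definition lifting (k : nat) (w : seq letter) : X :=
  k%:R^-1 *: \sum_(t < k) Xbasis sc (2 ^ k + t * k + pickle w).

Lemma liftingE k w p i : (4 <= k)%N -> (pickle w < k)%N ->
  fval (lifting k w) (p, i) =
  k%:R^-1 * \sum_(t < k) if (p <= 2 ^ k + t * k + pickle w)%N then atom w i else 0.
Proof.
move=> k4 wk; rewrite fvalZ fval_sum; congr (_ * _); apply: eq_bigr => t _.
by rewrite XbasisE /gen scheduleE // pickle_decode.
Qed.

Lemma tsum_lifting k w i : (4 <= k)%N -> (pickle w < k)%N -> tsum (lifting k w) i = atom w i.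
Proof.
move=> k4 wk; rewrite /tsum liftingE //= sumr_const card_ord -[atom w i *+ k]mulr_natl mulKf //.
by rewrite pnatr_eq0; lia.
Qed.

Lemma nr_atom w i : nr (atom w i) <= 1.
Proof.
by rewrite -(emb_mono sc) -nrE rmorph1 atom_le1.
Qed.

(** Let z be the sum of the c w atom w.  A tail of the lifting of z consists of
    complete rounds, each contributing z / k, and of at most one incomplete
    round, which contributes at most k * B / k since there are at most k words.
    Both contributions are bounded by B. *)
Lemma lifting_bound k (ws : seq (seq letter)) (c : seq letter -> K) (B : R) :
  (4 <= k)%N -> uniq ws -> (forall w, w \in ws -> (pickle w < k)%N) ->
  (forall w, w \in ws -> nr (c w) <= B) -> 0 <= B ->
  (forall i, nr (\sum_(w <- ws) c w * atom w i) <= B) ->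
  fnorm (\sum_(w <- ws) c w *: lifting k w) <= 2 * B.
Proof.
move=> k4 uws wsk cB B0 zB.
apply: tail_norm_le => -[p i].
pose S (t : nat) : K := \sum_(w <- ws)
  c w * (if (p <= 2 ^ k + t * k + pickle w)%N then atom w i else 0).
have k0 : (0 : R) < k%:R by rewrite ltr0n; lia.
have -> : fval (\sum_(w <- ws) c w *: lifting k w) (p, i) = k%:R^-1 * \sum_(t < k) S t.
  rewrite fval_sum exchange_big mulr_sumr; apply: eq_big_seq => w /wsk wk.
  by rewrite fvalZ liftingE // mulrCA mulr_sumr.
have size_ws : (size ws <= k)%N.
  rewrite -(size_map pickle) -[k in (_ <= k)%N](size_iota 0 k); apply: uniq_leq_size.
    by rewrite map_inj_uniq //; exact: pcan_inj pickleK.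
  by move=> _ /mapP[w /wsk wk ->]; rewrite mem_iota.
(* The only round that position p can interrupt. *)
pose t0 := ((p - 2 ^ k) %/ k)%N.
have SB t : nr (S t) <= B + (t == t0)%:R * (k%:R * B).
  case: (ltngtP t t0) => [tt|tt|->]; rewrite /= ?mul0r ?addr0.
  - rewrite /S big_seq big1 ?nr0 // => w /wsk wk; rewrite ifF ?mulr0 //.
    have : (t.+1 * k <= p - 2 ^ k)%N by rewrite -leq_divRL //; lia.
    by rewrite mulSn; move: (2 ^ k)%N (t * k)%N; lia.
  - rewrite /S (eq_bigr (fun w => c w * atom w i)) => [|w _]; first exact: zB.
    rewrite ifT //.
    have : (p - 2 ^ k < t * k)%N by rewrite -ltn_divLR //; lia.
    by move: (2 ^ k)%N (t * k)%N; lia.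
  - rewrite mul1r; apply: (@le_trans _ _ (k%:R * B)); last by rewrite lerDr.
    apply: le_trans (nr_sum _ _ _ _) _.
    apply: (@le_trans _ _ (\sum_(w <- ws) B)).
      rewrite big_seq [leRHS]big_seq; apply: ler_sum => w /cB cwB.
      rewrite nrM; apply: le_trans cwB; rewrite ler_piMr ?nr_ge0 //.
      by case: ifP => _; rewrite ?nr_atom // nr0.
    by rewrite big_const_seq count_predT iter_addr_0 -[B *+ _]mulr_natl ler_wpM2r // ler_nat.
have nrV : nr k%:R^-1 = k%:R^-1.
  by rewrite -(rmorph_nat emb) -fmorphV nr_emb ger0_norm // invr_ge0 ltW.
rewrite nrM nrV mulrC ler_pdivrMr //.
apply: le_trans (nr_sum _ _ _ _) _.
apply: (@le_trans _ _ (\sum_(t < k) (B + (t == t0 :> nat)%:R * (k%:R * B)))).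
  by apply: ler_sum => t _; exact: SB.
rewrite big_split /= sumr_const card_ord -mulr_suml.
have : \sum_(t < k) (t == t0 :> nat)%:R <= 1 :> R.
  case: (ltnP t0 k) => tk.
    rewrite (bigD1 (Ordinal tk)) //= eqxx big1 ?addr0 // => t.
    by rewrite -val_eqE /= => /negPf->.
  rewrite big1 // => t _; case: eqP => // tt.
  by move: (ltn_ord t); rewrite tt ltnNge tk.
move=> h; have kB : 0 <= k%:R * B by rewrite mulr_ge0 // ltW.
have := ler_wpM2r kB h; rewrite mul1r => h2.
apply: le_trans (lerD (lexx _) h2) _.
rewrite -[B *+ k]mulr_natl (_ : _ + _ = 2 * B * k%:R) //; ring.
Qed.

End Lifting.

Section LevelAvg.
Context (K : numFieldType).

Lemma level_avg_lin n (a : K) (F G : seq letter -> tone -> K) :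
  level_avg n (fun u v => a * F u v + G u v) = a * level_avg n F + level_avg n G.
Proof.
rewrite /level_avg mulrCA -mulrDr; congr (_ * _).
rewrite mulr_sumr -big_split; apply: eq_bigr => u _ /=.
by rewrite mulr_sumr -big_split.
Qed.

Lemma level_avg_sum n (ws : seq (seq letter)) (F : seq letter -> seq letter -> tone -> K) :
  level_avg n (fun u v => \sum_(w <- ws) F w u v) = \sum_(w <- ws) level_avg n (F w).
Proof.
elim: ws => [|w ws IH].
  rewrite big_nil -[RHS](level_avg0 K n); apply: level_avgE => u v _.
  by rewrite big_nil.
rewrite big_cons -IH -[level_avg n (F w)]mul1r -level_avg_lin.
by apply: level_avgE => u v _; rewrite big_cons mul1r.
Qed.

Lemma alpha_sigma_lin n w (a : K) (f g : site -> K) :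
  alpha_sigma n w (a *: f + g) = a * alpha_sigma n w f + alpha_sigma n w g.
Proof.
rewrite /alpha_sigma -level_avg_lin; apply: level_avgE => u v _.
by rewrite mulrCA -mulrDr.
Qed.

Lemma alpha_sigma0 n w : alpha_sigma n w (0 : site -> K) = 0.
Proof. exact: (linear_at0 (V := K^o) (alpha_sigma_lin n w)). Qed.

Lemma alpha_tau_lin n w (a : K) (f g : site -> K) :
  alpha_tau n w (a *: f + g) = a * alpha_tau n w f + alpha_tau n w g.
Proof.
rewrite /alpha_tau -level_avg_lin; apply: level_avgE => u v _.
by rewrite mulrCA -mulrDr.
Qed.

End LevelAvg.

Section Trace.
Context (R : realType) (K : numFieldType) (sc : scalars R K).
Local Notation nr := (nr sc).
Local Notation emb := (emb sc).
Local Notation X := (felt (Xspace sc)).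
Local Notation Y := (felt (Yspace sc)).
Local Notation atom := (atom K).
Local Notation wt n := (emb (weight R n)).

Lemma level_avg_nr n (F : seq letter -> tone -> K) B :
  (forall u v, size u = n -> nr (F u v) <= B) -> nr (level_avg n F) <= B.
Proof.
move=> FB; rewrite -(emb_mono sc) -nrE; apply: level_avg_le => u v su.
by rewrite (nrE sc) (emb_mono sc) FB.
Qed.

Lemma nr_sigma w u v : nr (sigma K w u v) = 1.
Proof. by apply: (emb_inj (sc := sc)); rewrite -nrE rmorph1 norm_sigma. Qed.

Lemma nr_tau w u v : nr (tau K w u v) <= 1.
Proof.
rewrite -(emb_mono sc) -nrE rmorph1; case: w => [|b w]; first by rewrite normr0.
by rewrite norm_tau.
Qed.

Lemma alpha_sigma_nr n w f B : (forall i, nr (f i) <= B) -> nr (alpha_sigma n w f) <= B.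
Proof. by move=> fB; apply: level_avg_nr => u v _; rewrite nrM nr_sigma mul1r. Qed.

Lemma alpha_tau_nr n w f B : (forall i, nr (f i) <= B) -> nr (alpha_tau n w f) <= B.
Proof.
move=> fB; apply: level_avg_nr => u v _; apply: le_trans (fB (u, v)).
by rewrite nrM ler_piMl ?nr_ge0 // nr_tau.
Qed.

Lemma alpha_sigma_damp n w f : alpha_sigma n w (damp sc f) = wt n * alpha_sigma n w f.
Proof.
rewrite -[RHS]addr0 -(level_avg0 K n) -level_avg_lin; apply: level_avgE => u v su.
by rewrite /damp /= su addr0 mulrCA.
Qed.

Lemma alpha_tau_damp n w f : alpha_tau n w (damp sc f) = wt n * alpha_tau n w f.
Proof.
rewrite -[RHS]addr0 -(level_avg0 K n) -level_avg_lin; apply: level_avgE => u v su.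
by rewrite /damp /= su addr0 mulrCA.
Qed.

Lemma Ycarrier_eq0 (L : (site -> K) -> K) (C : R) : 0 <= C ->
  (forall a f g, L (a *: f + g) = a * L f + L g) ->
  (forall f B, (forall i, nr (f i) <= B) -> nr (L f) <= C * B) ->
  (forall j, L (damp sc (gen K j)) = 0) ->
  forall y, Ycarrier sc y -> L y = 0.
Proof.
move=> C0 Llin Lbd Lgen y Yy.
apply: (@nr_small_eq0 _ _ sc _ (2 * C)); first by rewrite mulr_ge0.
move=> e e0; have [x yx] := Yy _ e0; have [n [a xa]] := tsum_approx x e0.
pose h : site -> K := \sum_(j < n) a j *: damp sc (gen K j).
have hE i : h i = damp sc (fun i => \sum_(j < n) a j * gen K j i) i.
  rewrite /h /damp; elim: (n) => [|m IH]; first by rewrite !big_ord0 mulr0.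
  rewrite !big_ord_recr /= mulrDr -IH [LHS]/(_ + a m * _).
  by congr (_ + _); rewrite /damp mulrCA.
have Lh : L h = 0.
  rewrite /h (linear_comb (V := K^o) Llin) big1 // => j _.
  by rewrite Lgen scaler0.
have -> : L y = L (-1 *: h + y) by rewrite Llin Lh mulr0 add0r.
rewrite (mulrC 2) -mulrA; apply: Lbd => i.
have -> : (-1 *: h + y) i = (y i - damp sc (tsum x) i) + (damp sc (tsum x) i - h i).
  by rewrite [LHS]/(-1 * h i + y i) mulN1r addrA subrK addrC.
rewrite mulr_natl mulr2n; apply: le_trans (nrD _ _ _) _; apply: lerD => //.
by rewrite hE -mulrBr; apply: le_trans (xa i); exact: nr_weight_le.
Qed.

Lemma nr_wtV n : nr (wt n)^-1 = (weight R n)^-1.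
Proof. by rewrite -fmorphV nr_emb ger0_norm // invr_ge0 ltW // weight_gt0. Qed.

(** Both functionals are rescaled by the weight of the level on which they are
    computed, so that they coincide on damped atoms, hence on Y. *)
Lemma alpha_switch n w (y : Y) : size w = n.+1 ->
  (wt n.+1)^-1 * alpha_sigma n.+1 w (fval y) = (wt n)^-1 * alpha_tau n w (fval y).
Proof.
move=> sw; apply/eqP; rewrite -subr_eq0; apply/eqP.
pose L f := (wt n.+1)^-1 * alpha_sigma n.+1 w f - (wt n)^-1 * alpha_tau n w f.
have wV0 m : 0 <= (weight R m)^-1 by rewrite invr_ge0 ltW // weight_gt0.
apply: (@Ycarrier_eq0 L ((weight R n.+1)^-1 + (weight R n)^-1)) (carrier_fval y).
- exact: addr_ge0.
- by move=> a f g; rewrite /L alpha_sigma_lin alpha_tau_lin; ring.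
- move=> f B fB; apply: le_trans (nrB _ _ _) _; rewrite mulrDl (nrM _ (wt n.+1)^-1) (nrM _ (wt n)^-1) !nr_wtV.
  apply: lerD; (apply: ler_wpM2l; first exact: wV0).
    exact: alpha_sigma_nr.
  exact: alpha_tau_nr.
- move=> j; rewrite /L alpha_sigma_damp alpha_tau_damp !mulKf ?weight_neq0 //.
  by rewrite alpha_sigma_atom // alpha_tau_atom // subrr.
Qed.

(** The normalized trace of Q on the atoms of the words of length n, lifted to X.
    The weight makes it equal to 1 for damped_sum. *)
Definition trace (k n : nat) (Q : X -> Y) : K :=
  16 ^- n * \sum_(w <- words n) (wt n)^-1 * alpha_sigma n w (fval (Q (lifting sc k w))).

(** What is required of k for lifting to be defined on all the words of length at
    most N with the bound of lifting_bound. *)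
Definition admissible (k N : nat) :=
  (4 <= k)%N /\ forall w : seq letter, (size w <= N)%N -> (pickle w < k)%N.

(** The functionals being computed by tau for words of length n + 1 and by sigma
    for words of length n, both traces are averages over the sites (u, v) of
    level n, and their difference is the average of the values at (u, v) of Q
    applied to the lifting of a vector which is small by davie_small.  The ratio
    is 2/3 = (1/2) / (3/4). *)
Lemma trace_step k N n (Q : X -> Y) M : admissible k N -> (n < N)%N -> linear Q ->
  (forall x, fnorm (Q x) <= M * fnorm x) -> 0 <= M ->
  nr (trace k n.+1 Q - trace k n Q) <= 4 * M * (2 / 3) ^+ n.
Proof.
move=> [k4 kN] nN Qlin QM M0.
pose z u v := \sum_(w <- davie_words n) davie_coef K n u v w *: lifting sc k w.
have -> : trace k n.+1 Q - trace k n Q =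
    (wt n)^-1 * level_avg n (fun u v => fval (Q (z u v)) (u, v)).
  have E u v : fval (Q (z u v)) (u, v) =
      16 ^- n.+1 * (\sum_(w <- words n.+1) tau K w u v * fval (Q (lifting sc k w)) (u, v))
    + (- 16 ^- n * (\sum_(w <- words n) sigma K w u v * fval (Q (lifting sc k w)) (u, v)) + 0).
    by rewrite /z (linear_comb Qlin) sum_davie fvalB !fvalZ !fval_sum addr0 mulNr.
  rewrite (level_avgE (fun u v _ => E u v)) !level_avg_lin level_avg0 addr0 !level_avg_sum.
  rewrite mulrDr /trace; congr (_ + _).
    rewrite mulrCA; congr (_ * _); rewrite mulr_sumr; apply: eq_big_seq => w /size_words sw.
    exact: alpha_switch.
  by rewrite mulNr mulrN; congr (- _); rewrite mulrCA; congr (_ * _); rewrite mulr_sumr.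
rewrite nrM nr_wtV mulrC ler_pdivrMr ?weight_gt0 //.
have -> : 4 * M * (2 / 3) ^+ n * weight R n = M * (2 * (2 * 2 ^- n)).
  rewrite /weight -mulrA -exprMn (_ : 2 / 3 * (3 / 4) = 2^-1); last by field.
  by rewrite exprVn; ring.
apply: level_avg_nr => u v su.
apply: le_trans (fnorm_ge _ _) _; apply: le_trans (QM _) _; rewrite ler_wpM2l //.
have h0 : 0 <= 2 ^- n :> R by exact: half_ge0.
apply: lifting_bound => //.
- rewrite cat_uniq !uniq_words andbT /=; apply/hasPn => w; rewrite mem_words => /eqP sw.
  by rewrite -[_ \in _]/(w \in words n.+1) mem_words sw ltn_eqF.
- by move=> w; rewrite mem_cat !mem_words => /orP[] /eqP sw; apply: kN; rewrite sw // ltnW.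
- move=> w _.
  have p16 m : nr (16 ^- m) = 16 ^- m.
    rewrite (_ : 16 ^- m = emb (16 ^- m)); last by rewrite fmorphV rmorphXn rmorph_nat.
    by rewrite nr_emb ger0_norm // invr_ge0 exprn_ge0.
  have le16 : 16 ^- n <= 2 * 2 ^- n :> R.
    apply: (@le_trans _ _ (2 ^- n)); last by rewrite mulr_natl mulr2n lerDl.
    by rewrite lef_pV2 ?posrE ?exprn_gt0 //; apply: lerXn2r; rewrite ?nnegrE // ler_nat.
  apply: le_trans le16; rewrite /davie_coef; case: ifP => _.
    rewrite nrM p16; apply: (@le_trans _ _ (16 ^- n.+1)).
      by rewrite ler_piMr ?nr_tau // invr_ge0 exprn_ge0.
    by rewrite lef_pV2 ?posrE ?exprn_gt0 // ler_eXn2l // ltr1n.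
  by rewrite nrN nrM p16 nr_sigma mulr1.
- exact: mulr_ge0.
- move=> i; rewrite -(emb_mono sc) -nrE.
  apply: le_trans (davie_small K v i su) _.
  by rewrite rmorphM fmorphV rmorphXn rmorph_nat.
Qed.

(** The constant is 2 for the trace of level 0, plus 4 / (1 - 2/3) = 12. *)
Lemma trace_bound k N (Q : X -> Y) M : admissible k N -> linear Q ->
  (forall x, fnorm (Q x) <= M * fnorm x) -> 0 <= M ->
  nr (trace k N Q) <= 14 * M.
Proof.
move=> adm Qlin QM M0.
have H n : (n <= N)%N -> nr (trace k n Q) <= M * (14 - 12 * (2 / 3) ^+ n).
  elim: n => [_|n IH nN].
    rewrite /trace sum_words0 expr0 invr1 mul1r (_ : wt 0 = 1) ?invr1 ?mul1r; last first.
      by rewrite /weight expr0 rmorph1.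
    rewrite (_ : _ - _ = 2); last by rewrite expr0; ring.
    apply: alpha_sigma_nr => i; apply: le_trans (fnorm_ge _ _) _.
    apply: le_trans (QM _) _; rewrite ler_wpM2l //.
    have := @lifting_bound _ _ sc k [:: [::]] (fun=> 1) 1.
    rewrite big_seq1 scale1r mulr1; case: adm => k4 kN; apply => //.
    - by move=> w; rewrite inE => /eqP->; exact: kN.
    - by move=> w _; rewrite nr1.
    - by move=> j; rewrite big_seq1 mul1r nr_atom.
  rewrite -[trace _ _ _](subrK (trace k n Q)); apply: le_trans (nrD _ _ _) _.
  apply: le_trans (lerD (trace_step adm nN Qlin QM M0) (IH (ltnW nN))) _.
  by rewrite exprS (_ : _ + _ = M * (14 - 12 * (2 / 3 * (2 / 3) ^+ n))) //; field.
apply: le_trans (H N (leqnn N)) _; rewrite mulrC ler_wpM2r //.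
by rewrite gerBl mulr_ge0 // exprn_ge0 // divr_ge0.
Qed.

Lemma trace_damped_sum k N : admissible k N -> trace k N (damped_sum sc) = 1.
Proof.
move=> [k4 kN].
rewrite /trace (eq_big_seq (fun=> 1)) => [|w].
  by rewrite sum_words1 mulVf // expf_neq0 // pnatr_eq0.
rewrite mem_words => /eqP sw.
have -> : fval (damped_sum sc (lifting sc k w)) = damp sc (atom w).
  apply/funext => i; rewrite damped_sumE /damp tsum_lifting //.
  by apply: kN; rewrite sw.
by rewrite alpha_sigma_damp mulKf ?weight_neq0 // alpha_sigma_atom // eqxx.
Qed.

Lemma traceD k n (Q1 Q2 : X -> Y) :
  trace k n (fun x => Q1 x + Q2 x) = trace k n Q1 + trace k n Q2.
Proof.
rewrite /trace -mulrDr -big_split; congr (_ * _); apply: eq_bigr => w _ /=.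
rewrite -mulrDr; congr (_ * _).
by rewrite -[alpha_sigma n w (fval (Q1 _))]mul1r -alpha_sigma_lin scale1r.
Qed.

Definition cutoff (N : nat) : nat :=
  (4 + \max_(w <- flatten [seq words n | n <- iota 0 N.+1]) (pickle w).+1)%N.

Lemma cutoff_admissible N : admissible (cutoff N) N.
Proof.
split; first exact: leq_addr.
move=> w wN; apply: leq_trans (leq_addl _ _).
apply: (@leq_bigmax_seq _ _ xpredT (fun w : seq letter => (pickle w).+1)) => //.
by apply/flatten_mapP; exists (size w); rewrite ?mem_iota ?mem_words.
Qed.

(** The traces up to level N require liftings adapted to N, so the limit is taken
    along the cutoffs. *)
Definition trace_null (Q : X -> Y) := forall eps, 0 < eps ->
  exists N0, forall N, (N0 <= N)%N -> nr (trace (cutoff N) N Q) <= eps.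

Lemma trace_nullD Q1 Q2 : trace_null Q1 -> trace_null Q2 ->
  trace_null (fun x => Q1 x + Q2 x).
Proof.
move=> n1 n2 e e0; have e20 : 0 < e / 2 by rewrite divr_gt0.
have [N1 h1] := n1 _ e20; have [N2 h2] := n2 _ e20; exists (maxn N1 N2) => N.
rewrite geq_max => /andP[/h1 b1 /h2 b2]; rewrite traceD.
by apply: le_trans (nrD _ _ _) _; rewrite [leRHS]splitr lerD.
Qed.

Definition rank_one p (y : Y) (x : X) : Y := fval x p *: y.

Lemma rank_one_linear p y : linear (rank_one p y).
Proof. by move=> a x x'; rewrite /rank_one fvalD fvalZ scalerDl scalerA. Qed.

Lemma rank_one_bound p y x : fnorm (rank_one p y x) <= fnorm y * fnorm x.
Proof. by rewrite /rank_one fnormZ mulrC ler_wpM2l ?fnorm_ge0 // fnorm_ge. Qed.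

(** If y is the image of a finite combination of basis vectors, the trace is 0 at
    all levels above the lengths of the words involved.  Such y are dense in Y,
    and the traces are uniformly bounded. *)
Lemma trace_rank_one p (y : Y) : trace_null (rank_one p y).
Proof.
(* The distance of y to the dense set is made at most 4 * (e / 56), and 56 is
   4 times the constant 14 of trace_bound. *)
move=> e e0; have e1 : 0 < e / 56 by rewrite divr_gt0.
have Yy : Ycarrier sc (fval y) by exact: (carrier_fval y).
have [x yx] := Yy _ e1; have [n [a xa]] := tsum_approx x e1.
pose x' : X := \sum_(j < n) a j *: Xbasis sc j.
have x'E i : tsum x' i = \sum_(j < n) a j * gen K j i.
  rewrite /tsum fval_sum; apply: eq_bigr => j _.
  by rewrite fvalZ.
have near : fnorm (y - damped_sum sc x') <= 2 * (e / 56 + e / 56).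
  apply: Ynorm_le => i; rewrite fvalB damped_sumE; apply: le_trans (nr_tri _ _ (damp sc (tsum x) i) _) _.
  rewrite lerD // -mulrBr; apply: le_trans (nr_weight_le _ _ _) _.
  by rewrite x'E.
exists (\max_(j < n) size (decode (schedule j))).+1 => N Nbig.
have -> : rank_one p y = (fun x => rank_one p (y - damped_sum sc x') x + rank_one p (damped_sum sc x') x).
  by apply/funext => t; rewrite /rank_one -scalerDr subrK.
rewrite traceD.
have -> : trace (cutoff N) N (rank_one p (damped_sum sc x')) = 0.
  rewrite /trace big1_seq ?mulr0 // => w /andP[_ /size_words sw].
  have -> : fval (rank_one p (damped_sum sc x') (lifting sc (cutoff N) w)) =
      fval (lifting sc (cutoff N) w) p *: damp sc (tsum x') + 0.
    by apply/funext => i; rewrite addr0.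
  rewrite alpha_sigma_lin alpha_sigma_damp.
  rewrite alpha_sigma0.
  have -> : alpha_sigma N w (tsum x') = 0; last by rewrite !mulr0 addr0 mulr0.
  transitivity (\sum_(j < n) a j * alpha_sigma N w (gen K j)).
    rewrite (_ : tsum x' = \sum_(j < n) a j *: gen K j); last first.
      by apply/funext => i; rewrite x'E fct_sumE.
    exact: (linear_comb (V := K^o) (alpha_sigma_lin N w)).
  rewrite big1 // => j _; rewrite alpha_sigma_atom // (_ : (w == _) = false) ?mulr0 //.
  apply/eqP => wE; have := @leq_bigmax _ (fun j : 'I_n => size (decode (schedule j))) j.
  by rewrite -wE sw => /(leq_trans Nbig); rewrite ltnn.
rewrite addr0; apply: le_trans (trace_bound (cutoff_admissible N) _ _ _) _.
- exact: rank_one_linear.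
- by move=> t; exact: rank_one_bound.
- exact: fnorm_ge0.
- by apply: le_trans (ler_wpM2l _ near) _ => //; lra.
Qed.

(** An operator vanishing where the coordinates of the list s vanish has finite
    rank.  By induction on s: if some x0 vanishes on s but not at p, a rank-one
    operator built on the coordinate p removes p from the list; otherwise the
    condition at p is redundant. *)
Lemma trace_finite_rank (s : seq (nat * site)) (G : X -> Y) : linear G ->
  (forall x : X, (forall p, p \in s -> fval x p = 0) -> G x = 0) -> trace_null G.
Proof.
elim: s G => [|p s IH] G Glin Gs.
  move=> e e0; exists 0%N => N _.
  rewrite /trace big1 ?mulr0 ?nr0 ?ltW // => w _; rewrite Gs //.
  by rewrite (_ : fval 0 = 0) // alpha_sigma0 mulr0.
have [[x0 x0s x0p]|none] := pselect (exists2 x0 : X,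
    (forall q, q \in s -> fval x0 q = 0) & fval x0 p != 0); last first.
  apply: IH => // x xs; apply: Gs => q; rewrite inE => /predU1P[->|]; last exact: xs.
  by apply/eqP/negPn/negP => xp; apply: none; exists x.
pose y := (fval x0 p)^-1 *: G x0.
have -> : G = (fun x => (G x - rank_one p y x) + rank_one p y x).
  by apply/funext => x; rewrite subrK.
apply: trace_nullD; last exact: trace_rank_one.
apply: IH => [a x x'|x xs].
  by rewrite Glin rank_one_linear opprD addrACA scalerBr.
have E : G x - rank_one p y x = G ((- (fval x p / fval x0 p)) *: x0 + x).
  by rewrite Glin /rank_one /y scalerA scaleNr addrC.
rewrite E; apply: Gs => q; rewrite inE fvalD fvalZ => /predU1P[->|qs].
  by rewrite mulNr divfK // addNr.
by rewrite (x0s _ qs) (xs _ qs) mulr0 addr0.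
Qed.

End Trace.

(** * Compactness and norm attainment *)
Lemma ultra_fmap (U V : Type) (f : U -> V) (F : set_system U) :
  UltraFilter F -> UltraFilter (f @ F).
Proof.
move=> FU; have PF : ProperFilter F by exact: ultra_proper.
split; first exact: fmap_proper_filter.
move=> G PG FG; rewrite predeqE => A; split=> [GA|/FG//].
have [//|FnA] := in_ultra_setVsetC (f @^-1` A) FU.
have GnA : G (~` A) by apply: FG.
have /filter_ex[x [Ax nAx]] : G (A `&` ~` A) by apply: filterI.
by [].
Qed.

Lemma filter_forall_in (U : Type) (I : eqType) (F : set_system U) (s : seq I)
  (P : I -> set U) : Filter F -> (forall i, i \in s -> F (P i)) ->
  F [set y | forall i, i \in s -> P i y].
Proof.
move=> FF; elim: s => [|i s IH] FP; first by apply: filterS filterT.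
have Fi : F (P i) by apply: FP; rewrite mem_head.
have Fs : F [set y | forall i, i \in s -> P i y].
  by apply: IH => j js; apply: FP; rewrite inE js orbT.
apply: filterS (filterI Fi Fs) => y [yi ys] j; rewrite inE => /predU1P[->//|].
exact: ys.
Qed.

Section OperatorNorm.
Context (R : realType) (K : numFieldType) (sc : scalars R K) (I J : Type).
Context (p : fspace sc I) (q : fspace sc J).
Local Notation nr := (nr sc).
Local Notation emb := (emb sc).
Implicit Types Q : felt p -> felt q.

(** The supremum in the definition of opnorm is a supremum in K; it is the image
    of the one in R because the upper bounds of a set of nonnegative elements
    are themselves nonnegative, hence in the image of emb. *)
Lemma opnormP Q M : (forall x, fnorm (Q x) <= M * fnorm x) ->
  exists2 o, opnorm Q = emb o & forall x, fnorm x <= 1 -> fnorm (Q x) <= o.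
Proof.
move=> QM; pose S := [set fnorm (Q x) | x in [set x | fnorm x <= 1]].
have S0 : S (fnorm (Q 0)) by exists 0 => //=; rewrite fnorm0.
have Sub : has_ubound S.
  exists `|M| => _ [x /= x1 <-]; apply: le_trans (QM x) _.
  apply: le_trans (ler_norm _) _; rewrite normrM ler_piMr //.
  by rewrite ger0_norm // fnorm_ge0.
have So x : fnorm x <= 1 -> fnorm (Q x) <= sup S.
  by move=> x1; apply: ub_le_sup => //; exists x.
exists (sup S) => //.
pose E := [set `|Q x| | x in [set x : felt p | `|x| <= 1]].
have normE (x : felt p) : (`|x| <= 1) = (fnorm x <= 1).
  by rewrite feltE -(rmorph1 emb) (emb_mono sc).
have supE : supremums E (emb (sup S)).
  split=> [_ [x /= + <-]|z zE].
    by rewrite normE feltE (emb_mono sc); exact: So.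
  have Ez x : fnorm x <= 1 -> `|Q x| <= z by move=> x1; apply: zE; exists x; rewrite //= normE.
  have z0 : 0 <= z by apply: le_trans (Ez 0 _); rewrite // fnorm0.
  rewrite (emb_nr_ge0 sc z0) (emb_mono sc); apply: ge_sup; first by exists (fnorm (Q 0)).
  by move=> _ [x /= x1 <-]; have := Ez x x1; rewrite feltE {1}(emb_nr_ge0 sc z0) (emb_mono sc).
rewrite /opnorm /supremum -/E ifF; last first.
  apply/eqP => E0; have : E `|Q 0| by exists 0; rewrite //= normr0.
  by rewrite E0.
exact: xget_subset1 supE (@is_subset1_supremums _ _ _).
Qed.

Lemma bounded_operatorP (S : {linear felt p -> felt q}) : bounded_operator S ->
  exists M : R, forall x, fnorm (S x) <= M * fnorm x.
Proof.
move=> [M SM]; exists (nr M) => x.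
have z0 : 0 <= M * `|x| by apply: le_trans (SM x).
rewrite -(emb_mono sc) -feltE; apply: le_trans (SM x) _.
rewrite (emb_nr_ge0 sc z0) (emb_mono sc) nrM feltE nr_emb ger0_norm //.
by rewrite -(emb_mono sc) rmorph0 -feltE.
Qed.

Lemma unit_ball_bound Q o : linear Q -> (forall x, fnorm x <= 1 -> fnorm (Q x) <= o) ->
  forall x, fnorm (Q x) <= o * fnorm x.
Proof.
move=> Qlin Qo x; have Q0 := linear_at0 Qlin.
have [x0|x0] := eqVneq (fnorm x) 0.
  by rewrite (fnorm_eq0 x0) Q0 !fnorm0 mulr0.
have xp : 0 < fnorm x by rewrite lt_neqAle eq_sym x0 fnorm_ge0.
have nV : nr (emb (fnorm x)^-1) = (fnorm x)^-1 by rewrite nr_emb ger0_norm // invr_ge0 ltW.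
have := Qo (emb (fnorm x)^-1 *: x + 0).
by rewrite Qlin Q0 !addr0 !fnormZ nV mulVf // mulrC ler_pdivrMr //; apply.
Qed.

End OperatorNorm.

Section Main.
Context (R : realType) (K : numFieldType) (sc : scalars R K).
Local Notation nr := (nr sc).
Local Notation emb := (emb sc).
Local Notation X := (felt (Xspace sc)).
Local Notation Y := (felt (Yspace sc)).
Local Notation T := (damped_sum sc).

(** The image of the unit ball is dominated by the weights.  An ultrafilter on it
    converges at each site, and the convergence is uniform because the weights
    are small outside of finitely many sites. *)
Lemma damped_sum_compact : compact_operator T.
Proof.
rewrite /compact_operator; set A := closure _.
have AT (y : Y) : A y -> forall i, nr (fval y i) <= weight R (size i.1).
  move=> Ay i; apply/ler_addgt0Pr => e e0.
  have ee0 : 0 < emb e by rewrite -(rmorph0 emb) (emb_lt sc).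
  have [_ [[x /= x1 <-] yx]] := Ay _ (nbhsx_ballx y _ ee0).
  have {}x1 : fnorm x <= 1 by rewrite -(emb_mono sc) rmorph1 -feltE.
  move: yx; rewrite -ball_normE /= feltE (emb_lt sc) => yx.
  rewrite -[fval y i](subrK (fval (T x) i)); apply: le_trans (nrD _ _ _) _.
  rewrite addrC lerD //.
    rewrite damped_sumE nr_damp ler_piMr ?(ltW (weight_gt0 _ _)) //.
    exact: le_trans (nr_tsum _ _) x1.
  by rewrite -fvalB; apply: le_trans (fnorm_ge _ _) (ltW yx).
rewrite compact_ultra => F FU FA; have PF : ProperFilter F by exact: ultra_proper.
have Fbound i : F [set y : Y | nr (fval y i) <= weight R (size i.1)].
  by apply: filterS FA => y Ay; exact: AT.
have /choice[l Fl] (i : site) : exists li, forall eps : R, 0 < eps ->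
    F [set y : Y | nr (fval y i - li) < eps].
  exact: (@nr_ultra _ _ sc ((fun y : Y => fval y i) @ F) _ (ultra_fmap _ FU) (Fbound i)).
have lbound i : nr (l i) <= weight R (size i.1).
  apply/ler_addgt0Pr => e e0.
  have /filter_ex[y /= [yw yl]] : F ([set y : Y | nr (fval y i) <= weight R (size i.1)]
      `&` [set y : Y | nr (fval y i - l i) < e]) by apply: filterI => //; exact: Fl.
  rewrite -[l i](subrK (fval y i)) addrC; apply: le_trans (nrD _ _ _) _.
  by rewrite [nr (l i - _)]nr_distC; exact: (lerD yw (ltW yl)).
have [eps e0|L _ FL] := pointwise_unif_cvg PF Fl; last first.
  exists L; split=> //=.
  exact: (@closed_cvg _ _ F _ id A (@closed_closure _ _) FA L FL).
exists l.
have e20 : 0 < eps / 2 by rewrite divr_gt0.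
have [N Nw] : exists N, forall n, (N <= n)%N -> weight R n <= eps / 2.
  have half1 : `|3 / 4 : R| < 1 by rewrite ger0_norm; lra.
  have /cvgrPdist_le /(_ _ e20)[N _ Nw] := @cvg_expr R _ half1.
  exists N => n /Nw; rewrite sub0r normrN ger0_norm //.
  by rewrite ltW // weight_gt0.
pose s := flatten [seq level_sites n | n <- iota 0 N].
have Fs : F [set y : Y | forall i, i \in s -> nr (fval y i - l i) < eps].
  by apply: (filter_forall_in (P := fun i => [set y : Y | nr (fval y i - l i) < eps])) => i _;
    exact: Fl.
apply: filterS (filterI FA Fs) => y [Ay ys] i /=.
case: (ltnP (size i.1) N) => iN.
  apply/ltW/ys/flatten_mapP; exists (size i.1); rewrite ?mem_iota //.
  by rewrite mem_level_sites.
apply: le_trans (nrB _ _ _) _; rewrite [leRHS]splitr lerD //.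
  exact: le_trans (AT _ Ay _) (Nw _ iN).
exact: le_trans (lbound _) (Nw _ iN).
Qed.

(** A vector of c_0 has finitely many coordinates of modulus at least 1/2; at the
    other ones there is room for perturbations of norm at most 1/2. *)
Lemma X_flat (x0 : X) : fnorm x0 = 1 -> exists s : seq (nat * site), forall y : X,
  (forall p, p \in s -> fval y p = 0) -> fnorm y <= 1 / 2 ->
  fnorm (x0 + y) <= 1 /\ fnorm (x0 - y) <= 1.
Proof.
move=> x01; have h0 : (0 : R) < 1 / 2 by rewrite divr_gt0.
have [s xs] := tail_vanishing x0 h0; exists s => y ys y1.
have B p : nr (fval x0 p) + nr (fval y p) <= 1.
  case: (boolP (p \in s)) => ps.
    by rewrite (ys _ ps) nr0 addr0 -x01 fnorm_ge.
  rewrite [leRHS](splitr 1) lerD // ?(ltW (xs _ ps)) //.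
  exact: le_trans (fnorm_ge _ _) y1.
by split; apply: tail_norm_le => p; [rewrite fvalD|rewrite fvalB];
  apply: le_trans (B p); [exact: nrD|exact: nrB].
Qed.

(** Where S attains its norm, S is constant along the flat directions given by
    X_flat, because Y is strictly convex: S vanishes on a subspace of finite
    codimension. *)
Lemma norm_attaining_null (S : {linear X -> Y}) : @norm_attaining K X Y S ->
  trace_null S.
Proof.
move=> [/bounded_operatorP[M SM'] [x0 [x01 Sx0]]].
have [o oE So] := opnormP SM'.
have n0 : fnorm x0 = 1 by apply: (emb_inj (sc := sc)); rewrite -feltE x01 rmorph1.
have So0 : fnorm (S x0) = o by apply: (emb_inj (sc := sc)); rewrite -feltE Sx0.
have [s xs] := X_flat n0.
apply: (@trace_finite_rank _ _ sc s S) => [|y ys]; first exact: linearP.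
have small (z : X) : (forall p, p \in s -> fval z p = 0) -> fnorm z <= 1 / 2 -> S z = 0.
  move=> zs z1; have [h1 h2] := xs z zs z1.
  by apply: (@Y_strict _ _ sc (S x0)); rewrite -?linearD -?linearB So0; exact: So.
have yp : 0 < 2 * (fnorm y + 1).
  by rewrite mulr_gt0 // ltr_wpDl // fnorm_ge0.
have c0 : emb (2 * (fnorm y + 1))^-1 != 0 by rewrite fmorph_eq0 invr_eq0 gt_eqF.
apply: (scalerI c0); rewrite scaler0 -linearZ; apply: small => [p ps|].
  by rewrite fvalZ ys // mulr0.
rewrite fnormZ nr_emb ger0_norm ?invr_ge0 ?(ltW yp) // mulrC ler_pdivrMr //.
lra.
Qed.

(** If S attains its norm, the traces of damped_sum, which are equal to 1, are the
    limit of the traces of damped_sum - S, which are at most 14 times its norm. *)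
Lemma damped_sum_not_approximable : ~ opnorm_closure (@norm_attaining K X Y) T.
Proof.
move=> /(_ (emb (1 / 28))).
rewrite -(rmorph0 emb) (emb_lt sc) => -[|S NAS]; first by rewrite divr_gt0.
have [/bounded_operatorP[M SM'] _] := NAS.
pose D (x : X) : Y := T x - S x.
have Dlin : linear D.
  by move=> a x y; rewrite /D (linearP T) (linearP S) opprD addrACA scalerBr.
have DM x : fnorm (D x) <= (2 + M) * fnorm x.
  rewrite mulrDl; apply: le_trans (lerD (damped_sum_bounded x) (SM' x)).
  rewrite -(emb_mono sc) rmorphD -!feltE; exact: ler_normB.
have [o oE Do] := opnormP DM.
rewrite [opnorm _]oE (emb_lt sc) => o28.
have o0 : 0 <= o.
  apply: le_trans (Do 0 _); first by rewrite fnorm_ge0.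
  by rewrite fnorm0.
have [N SN] : exists N0, forall N, (N0 <= N)%N -> nr (trace (cutoff N) N S) <= 1 / 4.
  by apply: (norm_attaining_null NAS); rewrite divr_gt0.
have := trace_damped_sum sc (cutoff_admissible N).
have -> : (T : X -> Y) = (fun x => D x + S x) by apply/funext => x; rewrite subrK.
rewrite traceD => tr1; have : (1 : R) <= 14 * o + 1 / 4.
  rewrite -[leLHS](nr1 sc) -tr1; apply: le_trans (nrD _ _ _) _; apply: lerD; last exact: (SN N (leqnn N)).
  apply: (trace_bound (cutoff_admissible N) Dlin _ o0).
  exact: (unit_ball_bound Dlin).
lra.
Qed.

Theorem counterexample : exists (X Y : completeNormedModType K) (T : {linear X -> Y}),
  [/\ exists e : nat -> X, schauder_basis e, compact_operator T
    & ~ opnorm_closure (@norm_attaining K X Y) T].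
Proof.
exists (felt (Xspace sc)), (felt (Yspace sc)), T; split.
- exists (Xbasis sc); exact: tail_schauder.
- exact: damped_sum_compact.
- exact: damped_sum_not_approximable.
Qed.

End Main.

(** * The real and the complex field *)
Section RealScalars.
Context (R : realType).

Lemma real_parallelogram (a b : R) :
  `|a + b| ^+ 2 + `|a - b| ^+ 2 = (`|a| ^+ 2 + `|b| ^+ 2) *+ 2.
Proof. rewrite !real_normK ?num_real //; ring. Qed.

Lemma real_ultra (F : set_system R) (B : R) : UltraFilter F ->
  F [set z | `|z| <= B] ->
  exists l, forall eps : R, 0 < eps -> F [set z | `|z - l| < eps].
Proof.
move=> FU FB; have := @segment_compact R (- B) B; rewrite compact_ultra => H.
have [|l [_ Fl]] := H F FU.
  by apply: filterS FB => z /=; rewrite ler_norml in_itv.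
exists l => eps e0; have /cvgrPdist_lt /(_ _ e0) := Fl.
by apply: filterS => z /=; rewrite distrC.
Qed.

Definition real_scalars : scalars R R :=
  @Scalars R R idfun (fun _ _ => erefl) (fun z => `|z|) (fun _ => erefl)
    real_parallelogram real_ultra.

End RealScalars.

Section ComplexScalars.
Context (R : realType).
Local Notation C := R[i].

Definition cmod (z : C) : R := Num.sqrt (complex.Re z ^+ 2 + complex.Im z ^+ 2).

Lemma cmodE z : `|z| = real_complex R (cmod z).
Proof. exact: normc_def. Qed.

Lemma cmod2 z : cmod z ^+ 2 = complex.Re z ^+ 2 + complex.Im z ^+ 2.
Proof. by rewrite sqr_sqrtr // addr_ge0 // sqr_ge0. Qed.

Lemma complex_parallelogram (a b : C) :
  cmod (a + b) ^+ 2 + cmod (a - b) ^+ 2 = (cmod a ^+ 2 + cmod b ^+ 2) *+ 2.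
Proof. by rewrite !cmod2; case: a => a1 a2; case: b => b1 b2 /=; ring. Qed.

Lemma cmod_Re z : `|complex.Re z| <= cmod z.
Proof.
apply: le_of_sqr; first exact: sqrtr_ge0.
by rewrite cmod2 real_normK ?num_real // lerDl sqr_ge0.
Qed.

Lemma cmod_Im z : `|complex.Im z| <= cmod z.
Proof.
apply: le_of_sqr; first exact: sqrtr_ge0.
by rewrite cmod2 real_normK ?num_real // lerDr sqr_ge0.
Qed.

Lemma cmod_le z : cmod z <= `|complex.Re z| + `|complex.Im z|.
Proof.
apply: le_of_sqr; first exact: addr_ge0.
rewrite cmod2 sqrrD !real_normK ?num_real // addrAC lerDl.
by rewrite mulrn_wge0 // mulr_ge0.
Qed.

Lemma complex_ultra (F : set_system C) (B : R) : UltraFilter F ->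
  F [set z | cmod z <= B] ->
  exists l, forall eps : R, 0 < eps -> F [set z | cmod (z - l) < eps].
Proof.
move=> FU FB; have PF : ProperFilter F by exact: ultra_proper.
have [|a Fa] := @real_ultra R _ B (ultra_fmap (@complex.Re R) FU).
  suff : F [set z | `|complex.Re z| <= B] by [].
  by apply: filterS FB => z /= zB; exact: le_trans (cmod_Re z) zB.
have [|b Fb] := @real_ultra R _ B (ultra_fmap (@complex.Im R) FU).
  suff : F [set z | `|complex.Im z| <= B] by [].
  by apply: filterS FB => z /= zB; exact: le_trans (cmod_Im z) zB.
exists (Complex a b) => eps e0; have e20 : 0 < eps / 2 by rewrite divr_gt0.
have Fab : F ([set z | `|complex.Re z - a| < eps / 2] `&` [set z | `|complex.Im z - b| < eps / 2]).
  by apply: filterI; [exact: Fa|exact: Fb].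
apply: filterS Fab => -[x y] /= [xa yb].
apply: le_lt_trans (cmod_le _) _; rewrite [ltRHS]splitr.
exact: ltrD.
Qed.

Lemma real_complex_mono : {mono real_complex R : x y / x <= y}.
Proof. exact: lecR. Qed.

Definition complex_scalars : scalars R C :=
  @Scalars R C (real_complex R) real_complex_mono cmod cmodE
    complex_parallelogram complex_ultra.

End ComplexScalars.

Theorem corollary4 (R : realType) :
  (exists (X Y : completeNormedModType R) (T : {linear X -> Y}),
      [/\ exists e : nat -> X, schauder_basis e,
          compact_operator T
        & ~ opnorm_closure (@norm_attaining R X Y) T]) /\
  (exists (X Y : completeNormedModType R[i]) (T : {linear X -> Y}),
      [/\ exists e : nat -> X, schauder_basis e,
          compact_operator T
        & ~ opnorm_closure (@norm_attaining R[i] X Y) T]).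
Proof.
split.
  exact: (counterexample (real_scalars R)).
exact: (counterexample (complex_scalars R)).
Qed.
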